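(* Let $(K,\{V_\lambda\}_{\lambda\in\widehat{A}})$ be a dynamical datum for $(H,A)$, and let $I(\lambda)\in H\otimes H$ ($\lambda\in\widehat{A}$) be the invertible elements constructed from it (and from a choice of isomorphisms $\omega_{\lambda,\mu}$) as in the context. Write $I(\lambda)^{-1}=I^{-1}(\lambda)\otimes I^{-2}(\lambda)$ (sum understood). Then $$J(\lambda)=\mathcal{S}^{-1}(I^{-2}(\lambda))\otimes\mathcal{S}^{-1}(I^{-1}(\lambda)),\qquad \lambda\in\widehat{A},$$ defines a dynamical twist $J:\widehat{A}\to H\otimes H$ for $H$.
   Context: **Conventions.** $\Bbbk$ is an algebraically closed field of characteristic $0$; $H$ is a finite-dimensional Hopf algebra over $\Bbbk$ with comultiplication $\Delta$, counit $\varepsilon$, antipode $\mathcal{S}$; $A$ is a finite abelian subgroup of the group $G(H)$ of group-like elements; $\widehat{A}$ is its character group. For $\mu\in\widehat{A}$, $P_\mu=\frac{1}{|A|}\sum_{a\in A}\mu(a^{-1})a$, and for an $A$-module $V$, $V[\mu]=\{v: a\cdot v=\mu(a)v\ \forall a\in A\}$. $\mathrm{Rep}(H)$ is the category of finite-dimensional left $H$-modules; $X^*$ is the dual module, $(h\cdot f)(x)=f(\mathcal{S}(h)x)$. All modules are finite-dimensional. **Dynamical twists.** A dynamical twist is a function $J:\widehat{A}\to H\otimes H$ with invertible values such that for all $\lambda\in\widehat{A}$, $a\in A$: $J(\lambda)(a\otimes a)=(a\otimes a)J(\lambda)$; $\sum_{\mu\in\widehat{A}}(\Delta\otimes \mathrm{id})J(\lambda)\,(J(\lambda\mu^{-1})\otimes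 P_\mu)=(\mathrm{id}\otimes\Delta)J(\lambda)\,(1\otimes J(\lambda))$; $(\varepsilon\otimes \mathrm{id})J(\lambda)=(\mathrm{id}\otimes\varepsilon)J(\lambda)=1$. **Comodule algebras.** A (finite-dimensional) left $H$-comodule algebra $K$ with coaction $\delta(k)=k_{(-1)}\otimes k_{(0)}$ is $H$-simple if it has no non-trivial two-sided ideal $I$ with $\delta(I)\subseteq H\otimes I$; $K^{\mathrm{co}H}=\{k:\delta(k)=1\otimes k\}$. For $X\in \mathrm{Rep}(H)$ and a left $K$-module $V$, $X\otimes_{\Bbbk}V$ is a $K$-module via $k\cdot(x\otimes v)=k_{(-1)}x\otimes k_{(0)}v$. **Yan–Zhu stabilizers.** For left $K$-modules $V,W$, let $\mathcal{L}:H^*\otimes\mathrm{Hom}(V,W)\to\mathrm{Hom}(H^*\otimes V,H^*\otimes W)$, $\mathcal{L}(\gamma\otimes T)(\xi\otimes v)=\gamma\xi\otimes T(v)$, and $\mathrm{Stab}_K(V,W)=\mathrm{Hom}_K(H^*\otimes V,H^*\otimes W)\cap\mathcal{L}(H^*\otimes\mathrm{Hom}(V,W))$, where $K$ acts on $H^*\otimes V$ by $k\cdot(\gamma\otimes v)=(k_{(-1)}\rightharpoondown\gamma)\otimes k_{(0)}v$ with $\langle h\rightharpoondown\gamma,t\rangle=\langle\gamma,\mathcal{S}^{-1}(h)t\rangle$. Elements of $H^*\otimes \mathrm{Hom}(V,W)$ are regarded as linear functions $G:H\to\mathrm{Hom}(V,W)$, and $H$ acts by $(h\cdot G)(t)=G(th)$.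 For $\mu\in\widehat{A}$, $C(\mu)=\{f\in H^*: f(ah)=\mu(a)f(h)\ \forall a\in A,h\in H\}$, an $H$-module via $(h\cdot f)(t)=f(th)$. **Dynamical data.** A dynamical datum for $(H,A)$ is $(K,\{V_\lambda\}_{\lambda\in\widehat{A}})$ where $K$ is an $H$-simple left $H$-comodule algebra, semisimple as an algebra, with $K^{\mathrm{co}H}=\Bbbk$, and $V_\lambda$ are irreducible $K$-modules such that for all $\lambda,\mu$ there are $H$-module isomorphisms $\mathrm{Stab}_K(V_\lambda,V_\mu)\simeq C(\lambda\mu^{-1})$. **The elements $I(\lambda)$.** Choose $H$-module isomorphisms $\omega_{\lambda,\mu}:\mathrm{Stab}_K(V_\lambda,V_\mu)\to C(\lambda\mu^{-1})$ such that $\omega_{\lambda,\lambda}$ sends the identity to the counit $\varepsilon$. For $X\in\mathrm{Rep}(H)$, $x\in X[\mu]$, define the $K$-map $\Psi(\lambda,x):X^*\otimes V_\lambda\to V_{\lambda\mu}$ by $\Psi(\lambda,x)(f\otimes v)=\omega_{\lambda,\lambda\mu}^{-1}(\widetilde f^{x})(1)(v)$ with $\widetilde f^{x}\in C(\mu^{-1})$, $\widetilde f^{x}(h)=f(\mathcal{S}(h)x)$; this gives a linear isomorphism $X[\mu]\simeq\mathrm{Hom}_K(X^*\otimes V_\lambda,V_{\lambda\mu})$. $I(\lambda)\in H\otimes H$ is the unique element such that for all $X,Y\in\mathrm{Rep}(H)$, $x\in X[\mu]$, $y\in Y[\eta]$: $\Psi(\lambda,I(\lambda)(x\otimes y))=\Psi(\lambda\mu,y)(\mathrm{id}_{Y^*}\otimes\Psi(\lambda,x))$,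 under the canonical identification $(X\otimes Y)^*\otimes V_\lambda\simeq Y^*\otimes(X^*\otimes V_\lambda)$. Each $I(\lambda)$ is invertible. *)

(* Defs.v *)
From HB Require Import structures.
From mathcomp Require Import all_boot all_fingroup all_algebra all_solvable all_field.

Set Implicit Arguments.
Unset Strict Implicit.
Unset Printing Implicit Defensive.

Import GRing.Theory.
Local Open Scope ring_scope.

Local Notation bilin f := (bilinear_for *:%R *:%R f).

Section Tensor.
Variable k : fieldType.
Implicit Types U V W : vectType k.

(* The tensor product of two finite-dimensional spaces, as the space of       *)
(* coefficient matrices with respect to the library's bases of the factors.   *)
(* It is only meant to be used through pure tensors (tpure) and through the   *)
(* universal property (tlift).                                                *)
Definition tens U V : Type := 'M[k]_(\dim {:U}, \dim {:V}).

HB.instance Definition _ U V :=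
  Vector.copy (tens U V) 'M[k]_(\dim {:U}, \dim {:V}).

Definition tpure U V (u : U) (v : V) : tens U V :=
  \matrix_(i, j) (coord (vbasis {:U}) i u * coord (vbasis {:V}) j v).

(* tlift f is always linear; it satisfies tlift f (u (x) v) = f u v when f is *)
(* bilinear (lemma tliftE), the only case in which it is used.                *)
Definition tlift U V W (f : U -> V -> W) (t : tens U V) : W :=
  \sum_i \sum_j (t : 'M[k]_(_, _)) i j *: f (vbasis {:U})`_i (vbasis {:V})`_j.

Fact tlift_is_linear U V W (f : U -> V -> W) : linear (tlift f).
Proof.
move=> c s t; rewrite /tlift scaler_sumr -big_split /=; apply: eq_bigr => i _.
rewrite scaler_sumr -big_split /=; apply: eq_bigr => j _.
by rewrite !mxE scalerDl scalerA.
Qed.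
HB.instance Definition _ U V W (f : U -> V -> W) :=
  GRing.isLinear.Build k (tens U V) W _ (tlift f) (tlift_is_linear f).

Lemma bilin_suml U V W (f : U -> V -> W) v n (c : 'I_n -> k) (u : 'I_n -> U) :
  bilin f -> f (\sum_i c i *: u i) v = \sum_i c i *: f (u i) v.
Proof.
case=> /(_ v) fl _; pose g : {linear U -> W} := HB.pack (f^~ v) (GRing.isLinear.Build k U W _ (f^~ v) fl).
rewrite -[LHS]/(g _) linear_sum; apply: eq_bigr => i _; exact: linearZ.
Qed.

Lemma bilin_sumr U V W (f : U -> V -> W) u n (c : 'I_n -> k) (v : 'I_n -> V) :
  bilin f -> f u (\sum_i c i *: v i) = \sum_i c i *: f u (v i).
Proof.
case=> _ /(_ u) fl; pose g : {linear V -> W} := HB.pack (f u) (GRing.isLinear.Build k V W _ (f u) fl).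
rewrite -[LHS]/(g _) linear_sum; apply: eq_bigr => i _; exact: linearZ.
Qed.

Lemma tpure_bilin U V : bilin (@tpure U V).
Proof.
split=> [v|u] c x y; apply/matrixP=> i j; rewrite !mxE linearP /=.
  by rewrite mulrDl mulrA.
by rewrite mulrDr mulrCA.
Qed.

Lemma tliftE U V W (f : U -> V -> W) u v :
  bilin f -> tlift f (tpure u v) = f u v.
Proof.
move=> fb; rewrite [in RHS](coord_vbasis (memvf u)) bilin_suml //.
apply: eq_bigr => i _.
rewrite [in RHS](coord_vbasis (memvf v)) bilin_sumr // scaler_sumr.
by apply: eq_bigr => j _; rewrite mxE scalerA.
Qed.

Lemma tens_decomp U V (t : tens U V) : t = tlift (@tpure U V) t.
Proof.
apply/matrixP=> a b; rewrite /tlift summxE (bigD1 a) //= summxE (bigD1 b) //=.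
have fU := basis_free (vbasisP {:U}); have fV := basis_free (vbasisP {:V}).
rewrite big1 => [|j /negPf jb]; last by rewrite !mxE !coord_free // jb !mulr0.
rewrite big1 => [|i /negPf ia]; last first.
  by rewrite summxE big1 // => j _; rewrite !mxE !coord_free // ia mul0r mulr0.
by rewrite !mxE !coord_free // !eqxx !mulr1 !addr0.
Qed.

Lemma tens_ext U V W (f g : tens U V -> W) :
    linear f -> linear g ->
  (forall u v, f (tpure u v) = g (tpure u v)) -> f =1 g.
Proof.
move=> fl gl fg t.
pose f' : {linear tens U V -> W} := HB.pack f (GRing.isLinear.Build k _ W _ f fl).
pose g' : {linear tens U V -> W} := HB.pack g (GRing.isLinear.Build k _ W _ g gl).
rewrite -[LHS]/(f' t) -[RHS]/(g' t) (tens_decomp t) /tlift !linear_sum.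
apply: eq_bigr => i _; rewrite !linear_sum; apply: eq_bigr => j _.
by rewrite !linearZ /= fg.
Qed.
End Tensor.

Infix "\ox" := tpure (at level 40, left associativity) : ring_scope.

Section TensorMaps.
Variable k : fieldType.
Implicit Types U V W : vectType k.

Definition tmap U V U' V' (f : 'Hom(U, U')) (g : 'Hom(V, V')) :
    'Hom(tens U V, tens U' V') :=
  linfun (tlift (fun u v => f u \ox g v)).

Lemma tmapE U V U' V' (f : 'Hom(U, U')) (g : 'Hom(V, V')) u v :
  tmap f g (u \ox v) = f u \ox g v.
Proof.
rewrite lfunE /= tliftE //; split=> [y|x] c a b /=; rewrite linearP.
  exact: (tpure_bilin U' V').1.
exact: (tpure_bilin U' V').2.
Qed.

Lemma tmap_bilin U V U' V' : bilin (@tmap U V U' V').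
Proof.
split=> [g|f] c x y; apply/lfunP; apply: tens_ext.
- by move=> d s t; rewrite linearP.
- by move=> d s t; rewrite linearP.
- move=> u v; rewrite add_lfunE scale_lfunE !tmapE add_lfunE scale_lfunE.
  exact: (tpure_bilin U' V').1.
- by move=> d s t; rewrite linearP.
- by move=> d s t; rewrite linearP.
- move=> u v; rewrite add_lfunE scale_lfunE !tmapE add_lfunE scale_lfunE.
  exact: (tpure_bilin U' V').2.
Qed.

Definition tflip U V : 'Hom(tens U V, tens V U) :=
  linfun (tlift (fun u v => v \ox u)).

Definition tassoc U V W : 'Hom(tens U (tens V W), tens (tens U V) W) :=
  linfun (tlift (fun u => tlift (fun v w => u \ox v \ox w))).

Lemma tflipE U V (u : U) (v : V) : tflip U V (u \ox v) = v \ox u.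
Proof.
rewrite lfunE /= tliftE //.
by split=> [y|x] c a b; [apply: (tpure_bilin V U).2 | apply: (tpure_bilin V U).1].
Qed.

Lemma tassocE U V W (u : U) (v : V) (w : W) :
  tassoc U V W (u \ox (v \ox w)) = u \ox v \ox w.
Proof.
have pl (X Y : vectType k) (y : Y) := (tpure_bilin X Y).1 y.
have pr (X Y : vectType k) (x : X) := (tpure_bilin X Y).2 x.
have inner (x : U) : bilin (fun (v : V) (w : W) => x \ox v \ox w).
  by split=> [z|y] c a b; [rewrite /= pr pl | rewrite pr].
rewrite lfunE /= tliftE ?tliftE //; split=> [s|x] c a b; last by rewrite linearP.
move: s; apply: tens_ext => [d p q|d p q|y z]; first by rewrite linearP.
  by rewrite !linearP /= [in LHS]scalerDr addrACA.
by rewrite !tliftE //= !pl.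
Qed.

Definition tensv U V (U0 : {vspace U}) (V0 : {vspace V}) : {vspace tens U V} :=
  <<[seq u \ox v | u <- vbasis U0, v <- vbasis V0]>>%VS.

Definition dual V : vectType k := 'Hom(V, k^o).

Definition dpair U V (f : dual U) (g : dual V) : dual (tens U V) :=
  linfun (tlift (fun u v => (f u * g v : k^o))).

Lemma dpairE U V (f : dual U) (g : dual V) u v :
  dpair f g (u \ox v) = f u * g v.
Proof.
rewrite lfunE /= tliftE //; split=> [y|x] c a b /=; rewrite linearP /=.
  by rewrite mulrDl -mulrA.
by rewrite mulrDr mulrCA.
Qed.

Lemma dpair_bilin U V : bilin (@dpair U V).
Proof.
split=> [g|f] c x y; apply/lfunP; apply: tens_ext => [d s t|d s t|u v];
  rewrite ?linearP // add_lfunE scale_lfunE !dpairE add_lfunE scale_lfunE.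
  by rewrite mulrDl -mulrA.
by rewrite mulrDr mulrCA.
Qed.

(* linfun f is only meaningful when f is linear. *)
Lemma linfunE U V (f : U -> V) : linear f -> linfun f =1 f.
Proof.
move=> fl; pose g : {linear U -> V} := HB.pack f (GRing.isLinear.Build k U V _ f fl).
exact: (lfunE g).
Qed.

End TensorMaps.

Section TensorAlgebra.
Variables (k : fieldType) (A B : falgType k).

Definition tens_mulh : 'Hom(tens A B, 'End(tens A B)) :=
  linfun (tlift (fun a b => tmap (amull a) (amull b))).

Lemma tens_mulhE a b c d :
  tens_mulh (a \ox b) (c \ox d) = (a * c) \ox (b * d).
Proof.
rewrite lfunE /= tliftE ?tmapE ?lfunE //.
by split=> [y|x] e u v; rewrite linearP;
  [apply: (tmap_bilin _ _ _ _).1 | apply: (tmap_bilin _ _ _ _).2].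
Qed.

Definition tens_mul (s t : tens A B) : tens A B := tens_mulh s t.
Definition tens_one : tens A B := 1 \ox 1.

Fact tens_mulDl : left_distributive tens_mul +%R.
Proof. by move=> s t u; rewrite /tens_mul linearD add_lfunE. Qed.
Fact tens_mulDr : right_distributive tens_mul +%R.
Proof. by move=> s t u; rewrite /tens_mul linearD. Qed.
Fact tens_scalerAl c s t : c *: tens_mul s t = tens_mul (c *: s) t.
Proof. by rewrite /tens_mul linearZ scale_lfunE. Qed.
Fact tens_scalerAr c s t : c *: tens_mul s t = tens_mul s (c *: t).
Proof. by rewrite /tens_mul linearZ. Qed.

Let mul_linl t : linear (tens_mul^~ t).
Proof. by move=> c s u; rewrite tens_mulDl -tens_scalerAl. Qed.
Let mul_linr s : linear (tens_mul s).
Proof. by move=> c t u; rewrite tens_mulDr -tens_scalerAr. Qed.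

Fact tens_mulA : associative tens_mul.
Proof.
move=> s t u; move: s; apply: tens_ext => [||a b].
- exact: mul_linl.
- by move=> c x y; rewrite !mul_linl.
move: t; apply: tens_ext => [||a' b'].
- by move=> c x y; rewrite mul_linl mul_linr.
- by move=> c x y; rewrite mul_linr mul_linl.
move: u; apply: tens_ext => [||a'' b''].
- by move=> c x y; rewrite !mul_linr.
- exact: mul_linr.
by rewrite /tens_mul !tens_mulhE !mulrA.
Qed.

Fact tens_mul1 : left_id tens_one tens_mul.
Proof.
apply: tens_ext => [||a b]; [exact: mul_linr | by [] |].
by rewrite /tens_mul tens_mulhE !mul1r.
Qed.

Fact tens_mulr1 : right_id tens_one tens_mul.
Proof.
apply: tens_ext => [||a b]; [exact: mul_linl | by [] |].
by rewrite /tens_mul tens_mulhE !mulr1.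
Qed.

Fact tens_one_neq0 : tens_one != 0.
Proof.
have coord_neq0 (C : falgType k) : exists i, coord (vbasis {:C}) i 1 != 0.
  apply/existsP; apply: contraNT (oner_neq0 C) => /existsPn c0.
  rewrite (coord_vbasis (memvf 1)) big1 // => i _.
  by rewrite (eqP (negbNE (c0 i))) scale0r.
have [[i i0] [j j0]] := (coord_neq0 A, coord_neq0 B).
apply/eqP=> /matrixP/(_ i j)/eqP; rewrite !mxE mulf_eq0.
by rewrite (negPf i0) (negPf j0).
Qed.

HB.instance Definition _ := GRing.Zmodule_isNzRing.Build (tens A B)
  tens_mulA tens_mul1 tens_mulr1 tens_mulDl tens_mulDr tens_one_neq0.
HB.instance Definition _ :=
  GRing.Lmodule_isLalgebra.Build k (tens A B) tens_scalerAl.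
HB.instance Definition _ :=
  GRing.Lalgebra_isAlgebra.Build k (tens A B) tens_scalerAr.
HB.instance Definition _ := Algebra_isFalgebra.Build k (tens A B).

Lemma tens_mulE (a c : A) (b d : B) :
  (a \ox b) * (c \ox d) = (a * c) \ox (b * d).
Proof. exact: tens_mulhE. Qed.

Lemma tens_oneE : (1 : tens A B) = 1 \ox 1.
Proof. by []. Qed.

End TensorAlgebra.

(* The character group of a finite group A: it is finite because the values   *)
(* of a character are roots of 'X^#|A| - 1.                                   *)
Section CharacterGroup.
Variables (k : closedFieldType) (A : finGroupType).

Definition is_char (f : {ffun A -> k}) : bool :=
  (f 1%g == 1) && [forall a, forall b, f (a * b)%g == f a * f b].

Record charT := CharT { char_fun :> {ffun A -> k}; _ : is_char char_fun }.

HB.instance Definition _ := [isSub for char_fun].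
HB.instance Definition _ := [Choice of charT by <:].

Lemma char1 (mu : charT) : mu 1%g = 1.
Proof. by case: mu => f /= /andP[/eqP]. Qed.

Lemma charM (mu : charT) a b : mu (a * b)%g = mu a * mu b.
Proof. by case: mu => f /= /andP[_ /'forall_forallP/(_ a b)/eqP]. Qed.

Lemma charX (mu : charT) a n : mu (a ^+ n)%g = mu a ^+ n.
Proof. by elim: n => [|n IH]; rewrite ?char1 // expgS charM IH exprS. Qed.

Definition char_values : seq k :=
  sval (closed_field_poly_normal ('X^#|A| - 1 : {poly k})).

Lemma mem_char_values (mu : charT) a : mu a \in char_values.
Proof.
rewrite /char_values; case: closed_field_poly_normal => r /= Er.
have A0 : (0 < #|A|)%N by apply/card_gt0P; exists 1%g.
rewrite -root_prod_XsubC.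
have <- : 'X^#|A| - 1 = \prod_(z <- r) ('X - z%:P) :> {poly k}.
  by rewrite [LHS]Er lead_coefXnsubC // scale1r.
have aA : (a ^+ #|A| = 1)%g by rewrite -cardsT; apply: expg_cardG; rewrite inE.
by apply/rootP; rewrite !hornerE -charX aA char1 subrr.
Qed.

Definition char_code (mu : charT) : {ffun A -> 'I_(size char_values).+1} :=
  [ffun a => inord (index (mu a) char_values)].
Definition char_decode (c : {ffun A -> 'I_(size char_values).+1}) :
  option charT := insub [ffun a => char_values`_(c a)].

Lemma char_codeK : pcancel char_code char_decode.
Proof.
move=> mu; rewrite /char_decode.
have -> : [ffun a => char_values`_(char_code mu a)] = val mu.
  apply/ffunP=> a; rewrite !ffunE inordK; last by rewrite ltnS index_size.
  by rewrite nth_index ?mem_char_values.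
exact: valK.
Qed.

HB.instance Definition _ := PCanIsCountable char_codeK.
HB.instance Definition _ := isFinite.Build charT (pcan_enumP char_codeK).

Fact char_mul_subproof (mu nu : charT) : is_char [ffun a => mu a * nu a].
Proof.
rewrite /is_char !ffunE !char1 mulr1 eqxx.
by apply/'forall_forallP=> a b; rewrite !ffunE !charM mulrACA.
Qed.
Fact char_one_subproof : is_char [ffun=> 1].
Proof.
by rewrite /is_char ffunE eqxx; apply/'forall_forallP=> a b; rewrite !ffunE mulr1.
Qed.
Fact char_inv_subproof (mu : charT) : is_char [ffun a => (mu a)^-1].
Proof.
rewrite /is_char !ffunE char1 invr1 eqxx.
by apply/'forall_forallP=> a b; rewrite !ffunE charM invfM.
Qed.

Definition char_mul mu nu := CharT (char_mul_subproof mu nu).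
Definition char_one := CharT char_one_subproof.
Definition char_inv mu := CharT (char_inv_subproof mu).

Fact char_mulA : associative char_mul.
Proof. by move=> x y z; apply/val_inj/ffunP=> a; rewrite !ffunE mulrA. Qed.
Fact char_mul1 : left_id char_one char_mul.
Proof. by move=> x; apply/val_inj/ffunP=> a; rewrite !ffunE mul1r. Qed.
Fact char_mulV : left_inverse char_one char_inv char_mul.
Proof.
move=> x; apply/val_inj/ffunP=> a; rewrite !ffunE mulVf //.
apply: contra_eq_neq (char1 x) => xa0.
by rewrite -(mulgV a) charM xa0 mul0r eq_sym oner_eq0.
Qed.

HB.instance Definition _ := Finite_isGroup.Build charT
  char_mulA char_mul1 char_mulV.

End CharacterGroup.

HB.mixin Record Falgebra_isHopf (k : fieldType) H of Falgebra k H := {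
  comul : 'Hom(H, tens H H);
  counit : 'Hom(H, k^o);
  antipode : 'End(H);
  comulA : forall h,
    tmap comul \1%VF (comul h) = tassoc H H H (tmap \1%VF comul (comul h));
  counitl : forall h, tlift (fun a b => (counit a : k) *: b) (comul h) = h;
  counitr : forall h, tlift (fun a b => (counit b : k) *: a) (comul h) = h;
  comul1 : comul 1 = 1;
  comulM : forall g h, comul (g * h) = comul g * comul h;
  counit1 : counit 1 = 1;
  counitM : forall g h, counit (g * h) = counit g * counit h;
  antipodel : forall h,
    tlift (fun a b => antipode a * b) (comul h) = (counit h : k)%:A;
  antipoder : forall h,
    tlift (fun a b => a * antipode b) (comul h) = (counit h : k)%:A
}.

#[short(type="hopfType")]
HB.structure Definition Hopf (k : fieldType) :=
  { H of Falgebra_isHopf k H & Falgebra k H }.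

(* The antipode of a finite-dimensional Hopf algebra is bijective, so that    *)
(* its inverse as a linear map is a genuine two-sided inverse.                *)
Definition antipodeV (k : fieldType) (H : hopfType k) : 'End(H) :=
  (@antipode k H)^-1%VF.

Section Modules.
Variables (k : fieldType) (R : falgType k).

Record fdmod := FdMod {
  mod_space :> vectType k;
  mact : 'Hom(R, 'End(mod_space));
  mact1 : mact 1 = \1%VF;
  mactM : forall a b, mact (a * b) = (mact a \o mact b)%VF
}.

Definition submod (M : fdmod) (U : {vspace M}) : Prop :=
  forall r u, u \in U -> mact M r u \in U.

Definition simple_submod (M : fdmod) (U : {vspace M}) : Prop :=
  [/\ submod U, U <> 0%VS &
      forall U' : {vspace M}, submod U' -> (U' <= U)%VS -> U' = 0%VS \/ U' = U].

Definition irreducible (M : fdmod) : Prop := simple_submod {:M}.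

Definition semisimple (M : fdmod) : Prop :=
  exists n (U : 'I_n -> {vspace M}),
    [/\ forall i, simple_submod (U i),
        directv (\sum_i U i) & (\sum_i U i)%VS = {:M}%VS].

Let lmulE r : linfun (@amull k R) r = amull r.
Proof. exact: (lfunE (@amull k R : {linear R -> 'End(R)})). Qed.
Fact regmod_act1 : linfun (@amull k R) 1 = \1%VF.
Proof. by rewrite lmulE amull1. Qed.
Fact regmod_actM a b : linfun (@amull k R) (a * b) =
  (linfun (@amull k R) a \o linfun (@amull k R) b)%VF.
Proof. by apply/lfunP=> x; rewrite comp_lfunE !lmulE !lfunE /= mulrA. Qed.
Definition regmod := FdMod regmod_act1 regmod_actM.

Definition semisimple_alg : Prop := semisimple regmod.

Definition two_sided_ideal (I : {vspace R}) : Prop :=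
  forall r x, x \in I -> r * x \in I /\ x * r \in I.

End Modules.
Arguments mact {k R} f : rename.

Section HopfModules.
Variables (k : fieldType) (H : hopfType k).
Implicit Types X Y : fdmod H.

(* The action of H (x) H on X (x) Y. *)
Definition tact X Y : 'Hom(tens H H, 'End(tens X Y)) :=
  linfun (tlift (fun a b => tmap (mact X a) (mact Y b))).

Lemma tactE X Y a b : tact X Y (a \ox b) = tmap (mact X a) (mact Y b).
Proof.
rewrite lfunE /= tliftE //.
by split=> [y|x] e u v; rewrite linearP;
  [apply: (tmap_bilin _ _ _ _).1 | apply: (tmap_bilin _ _ _ _).2].
Qed.

Lemma tactM X Y s t : tact X Y (s * t) = (tact X Y s \o tact X Y t)%VF.
Proof.
apply/lfunP=> z; rewrite comp_lfunE.
move: s; apply: tens_ext => [c u v|c u v|a b].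
- by rewrite mulrDl -scalerAl linearP add_lfunE scale_lfunE.
- by rewrite linearP add_lfunE scale_lfunE.
move: t; apply: tens_ext => [c u v|c u v|a' b'].
- by rewrite mulrDr -scalerAr linearP add_lfunE scale_lfunE.
- by rewrite !linearP add_lfunE scale_lfunE linearP.
move: z; apply: tens_ext => [c u v|c u v|x y]; rewrite ?linearP //.
by rewrite tens_mulE !tactE !tmapE !mactM !comp_lfunE.
Qed.

Fact tensmod_act1 X Y : (tact X Y \o comul)%VF 1 = \1%VF.
Proof.
rewrite comp_lfunE comul1 tactE !mact1; apply/lfunP.
by apply: tens_ext => [c u v|c u v|x y]; rewrite ?linearP // tmapE !id_lfunE.
Qed.
Fact tensmod_actM X Y a b : (tact X Y \o comul)%VF (a * b) =
  ((tact X Y \o comul)%VF a \o (tact X Y \o comul)%VF b)%VF.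
Proof. by rewrite !comp_lfunE comulM tactM. Qed.

(* The tensor product in Rep(H): h (x (x) y) = h_(1) x (x) h_(2) y.           *)
Definition tensmod X Y : fdmod H :=
  FdMod (@tensmod_act1 X Y) (@tensmod_actM X Y).

End HopfModules.

Section ComoduleAlgebras.
Variables (k : fieldType) (H : hopfType k).

Record comodAlg := ComodAlg {
  comod_alg :> falgType k;
  coact : 'Hom(comod_alg, tens H comod_alg);
  coactA : forall c, tmap comul \1%VF (coact c)
                     = tassoc H H comod_alg (tmap \1%VF coact (coact c));
  coact_counit : forall c,
    tlift (fun h c' => (counit h : k) *: c') (coact c) = c;
  coact1 : coact 1 = 1;
  coactM : forall c d, coact (c * d) = coact c * coact d
}.

Definition Hsimple (K : comodAlg) : Prop :=
  forall I : {vspace K}, two_sided_ideal I ->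
    (forall c, c \in I -> coact K c \in tensv {:H} I) ->
  I = 0%VS \/ I = {:K}%VS.

Definition trivial_coinvariants (K : comodAlg) : Prop :=
  forall c : K, coact K c = 1 \ox c <-> c \in 1%VS.

(* The convolution product of H^*, with left factor gamma. *)
Definition convl (gamma : dual H) : 'End(dual H) :=
  linfun (fun xi : dual H => (dpair gamma xi \o comul)%VF).

Lemma convlE gamma xi : convl gamma xi = (dpair gamma xi \o comul)%VF.
Proof.
apply: (linfunE (f := fun xi : dual H => (dpair gamma xi \o comul)%VF)).
move=> c x y; apply/lfunP=> h.
by rewrite add_lfunE scale_lfunE !comp_lfunE (dpair_bilin _ _).2
           add_lfunE scale_lfunE.
Qed.

Lemma convl_linear : linear convl.
Proof.
move=> c x y; apply/lfunP=> xi; apply/lfunP=> h.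
by rewrite add_lfunE scale_lfunE !convlE add_lfunE scale_lfunE !comp_lfunE
           (dpair_bilin _ _).1 add_lfunE scale_lfunE.
Qed.

(* h _\ gamma : t |-> gamma (S^-1(h) t).                                      *)
Definition harp (h : H) : 'End(dual H) :=
  linfun (fun gamma : dual H => (gamma \o amull (antipodeV H h))%VF).

Lemma harpE h gamma t : harp h gamma t = gamma (antipodeV H h * t).
Proof.
rewrite (linfunE (f := fun gamma : dual H => (gamma \o amull (antipodeV H h))%VF)).
  by rewrite comp_lfunE lfunE.
by move=> c x y; apply/lfunP=> s; rewrite !(add_lfunE, scale_lfunE, comp_lfunE).
Qed.

(* (h . G)(t) = G(t h), for G : H -> W; used for H^* and for Stab.            *)
Definition hact (W : vectType k) (h : H) (G : 'Hom(H, W)) : 'Hom(H, W) :=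
  (G \o amulr h)%VF.

Section Stabilizer.
Variables (K : comodAlg) (V W : fdmod K).

(* The action of K on H^* (x) V.                                              *)
Definition dact (M : fdmod K) : 'Hom(K, 'End(tens (dual H) M)) :=
  (linfun (tlift (fun h c => tmap (harp h) (mact M c))) \o coact K)%VF.

Definition yzL (s : tens (dual H) 'Hom(V, W)) :
    'Hom(tens (dual H) V, tens (dual H) W) :=
  tlift (fun gamma T => tmap (convl gamma) T) s.

(* The elements of H^* (x) Hom(V, W) as functions H -> Hom(V, W).             *)
Definition tens_fun (s : tens (dual H) 'Hom(V, W)) : 'Hom(H, 'Hom(V, W)) :=
  tlift (fun (gamma : dual H) (T : 'Hom(V, W)) =>
           linfun (fun h : H => (gamma h : k) *: T)) s.

Lemma yzLE gamma T : yzL (gamma \ox T) = tmap (convl gamma) T.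
Proof.
rewrite /yzL tliftE //; split=> [S|g] c x y.
  by rewrite /= convl_linear; apply: (tmap_bilin _ _ _ _).1.
exact: (tmap_bilin _ _ _ _).2.
Qed.

Lemma tens_funE gamma T h : tens_fun (gamma \ox T) h = (gamma h : k) *: T.
Proof.
have lin (g : dual H) (S : 'Hom(V, W)) : linear (fun h : H => (g h : k) *: S).
  by move=> c x y; rewrite linearP scalerDl scalerA.
rewrite /tens_fun tliftE ?(linfunE (lin _ _)) //.
split=> [S|g] c x y; apply/lfunP=> z.
  by rewrite add_lfunE scale_lfunE /= !(linfunE (lin _ _)) add_lfunE scale_lfunE
             scalerDl scalerA.
by rewrite add_lfunE scale_lfunE !(linfunE (lin _ _)) scalerDr !scalerA mulrC.
Qed.

(* Stab_K(V, W), as a set of functions H -> Hom(V, W): yzL is injective, so   *)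
(* yzL s in Hom_K(H^* (x) V, H^* (x) W) is identified with s, hence with      *)
(* tens_fun s.                                                                *)
Definition Stab (G : 'Hom(H, 'Hom(V, W))) : Prop :=
  exists2 s, G = tens_fun s &
    forall c, (yzL s \o dact V c = dact W c \o yzL s)%VF.

End Stabilizer.

Definition stab_id (K : comodAlg) (V : fdmod K) : 'Hom(H, 'Hom(V, V)) :=
  tens_fun ((counit : dual H) \ox (\1%VF : 'End(V))).

(* H-module morphisms between the H-submodules P of Hom(H, W) and P' of       *)
(* Hom(H, W'), represented by functions whose values outside P are irrelevant. *)
Definition Hmor (W W' : vectType k) (P : 'Hom(H, W) -> Prop)
    (P' : 'Hom(H, W') -> Prop) (f : 'Hom(H, W) -> 'Hom(H, W')) : Prop :=
  [/\ forall G, P G -> P' (f G),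
      forall c G G', P G -> P G' -> f (c *: G + G') = c *: f G + f G' &
      forall h G, P G -> f (hact h G) = hact h (f G)].

Definition Hiso (W W' : vectType k) (P : 'Hom(H, W) -> Prop)
    (P' : 'Hom(H, W') -> Prop)
    (f : 'Hom(H, W) -> 'Hom(H, W')) (g : 'Hom(H, W') -> 'Hom(H, W)) : Prop :=
  [/\ Hmor P P' f, Hmor P' P g,
      forall G, P G -> g (f G) = G & forall G, P' G -> f (g G) = G].

End ComoduleAlgebras.

Section Dynamical.
Variables (k : closedFieldType) (H : hopfType k) (A : finGroupType).

Definition grouplike (g : H) : Prop := g <> 0 /\ comul g = g \ox g.

Definition grouplike_subgroup (iota : A -> H) : Prop :=
  [/\ injective iota, forall a, grouplike (iota a), iota 1%g = 1 &
      forall a b, iota (a * b)%g = iota a * iota b].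

Variable iota : A -> H.
Local Notation Ahat := (charT k A).

Definition Pchar (mu : Ahat) : H :=
  #|A|%:R^-1 *: \sum_(a : A) mu a^-1%g *: iota a.

Record dynamical_twist (J : Ahat -> tens H H) : Prop := DynamicalTwist {
  twist_unit : forall lambda, J lambda \is a GRing.unit;
  twist_weight : forall lambda a,
    J lambda * (iota a \ox iota a) = (iota a \ox iota a) * J lambda;
  twist_cocycle : forall lambda,
    \sum_(mu : Ahat) tmap comul \1%VF (J lambda)
                     * (J (lambda * mu^-1)%g \ox Pchar mu)
    = tassoc H H H (tmap \1%VF comul (J lambda) * (1 \ox J lambda));
  twist_counitl : forall lambda,
    tlift (fun a b : H => (counit a : k) *: b) (J lambda) = 1;
  twist_counitr : forall lambda,
    tlift (fun a b : H => (counit b : k) *: a) (J lambda) = 1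
}.

Definition weight (X : fdmod H) (mu : Ahat) (x : X) : Prop :=
  forall a, mact X (iota a) x = mu a *: x.

Definition Cmu (mu : Ahat) (f : dual H) : Prop :=
  forall a h, f (iota a * h) = mu a * f h.

Record dynamical_datum (K : comodAlg H) (V : Ahat -> fdmod K) : Prop :=
DynamicalDatum {
  datum_Hsimple : Hsimple K;
  datum_semisimple : semisimple_alg K;
  datum_coinvariants : trivial_coinvariants K;
  datum_irreducible : forall lambda, irreducible (V lambda);
  datum_stab : forall lambda mu, exists om omV,
    Hiso (@Stab k H K (V lambda) (V mu)) (Cmu (lambda * mu^-1)%g) om omV
}.

(* f~^x (h) = f(S(h) x).                                                      *)
Definition ftilde (X : fdmod H) (x : X) (f : dual X) : dual H :=
  linfun (fun h : H => f (mact X (antipode h) x)).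

Lemma ftildeE (X : fdmod H) (x : X) (f : dual X) h :
  ftilde x f h = f (mact X (antipode h) x).
Proof.
rewrite (linfunE (f := fun h : H => f (mact X (antipode h) x))) // => c u v.
by rewrite !linearP add_lfunE scale_lfunE linearP.
Qed.

(* Psi(lambda, x), where omV is the inverse of omega_{lambda, lambda mu} and  *)
(* x has weight mu.                                                           *)
Definition Psi (U W : vectType k) (omV : dual H -> 'Hom(H, 'Hom(U, W)))
    (X : fdmod H) (x : X) : 'Hom(tens (dual X) U, W) :=
  linfun (tlift (fun f u => omV (ftilde x f) 1 u)).

(* Y^* (x) (X^* (x) U) -> (X (x) Y)^* (x) U, sending g (x) (f (x) u) to       *)
(* (x (x) y |-> f(x) g(y)) (x) u.                                             *)
Definition dual_tens_can (X Y U : vectType k) :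
    'Hom(tens (dual Y) (tens (dual X) U), tens (dual (tens X Y)) U) :=
  linfun (tlift (fun g => tlift (fun f u => dpair f g \ox u))).

Lemma dual_tens_canE (X Y U : vectType k) (f : dual X) (g : dual Y) (u : U) :
  dual_tens_can X Y U (g \ox (f \ox u)) = dpair f g \ox u.
Proof.
have inner (g' : dual Y) :
  bilin (fun (f' : dual X) (u' : U) => dpair f' g' \ox u').
  split=> [z|y] c a b; last exact: (tpure_bilin _ _).2.
  by rewrite /= (dpair_bilin _ _).1; apply: (tpure_bilin _ _).1.
rewrite lfunE /= tliftE ?tliftE //; split=> [s|x] c a b; last by rewrite linearP.
move: s; apply: tens_ext => [d p q|d p q|y z]; first by rewrite linearP.
  by rewrite !linearP /= [in LHS]scalerDr addrACA.
by rewrite !tliftE //= (dpair_bilin _ _).2; apply: (tpure_bilin _ _).1.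
Qed.

(* omV lambda mu is the inverse of omega_{lambda, mu}; the first conjunct     *)
(* makes Psi(lambda, I(lambda)(x (x) y)) meaningful.                          *)
Definition is_fusion (K : comodAlg H) (V : Ahat -> fdmod K)
    (omV : forall lambda mu, dual H -> 'Hom(H, 'Hom(V lambda, V mu)))
    (I : Ahat -> tens H H) : Prop :=
  forall (lambda mu eta : Ahat) (X Y : fdmod H) (x : X) (y : Y),
    weight mu x -> weight eta y ->
  let z : tensmod X Y := tact X Y (I lambda) (x \ox y) in
  weight (mu * eta)%g z /\
  (Psi (omV lambda (lambda * mu * eta)%g) z \o dual_tens_can X Y (V lambda)
   = Psi (omV (lambda * mu)%g (lambda * mu * eta)%g) y
     \o tmap \1 (Psi (omV lambda (lambda * mu)%g) x))%VF.

(* S^-1(I^-2) (x) S^-1(I^-1), where I^-1 = I^-1 (x) I^-2.                     *)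
Definition fusion_twist (I : Ahat -> tens H H) (lambda : Ahat) : tens H H :=
  tmap (antipodeV H) (antipodeV H) (tflip H H (I lambda)^-1).

End Dynamical.

(* Main.v *)
Require Import Defs.
From HB Require Import structures.
From mathcomp Require Import all_boot all_fingroup all_algebra all_solvable all_field.

Set Implicit Arguments.
Unset Strict Implicit.
Unset Printing Implicit Defensive.

Import GRing.Theory.
Local Open Scope ring_scope.

(** Why the theorem holds.

    A homomorphism X^* (x) V_lambda -> V_{lambda mu} of the form
    Psi(lambda, x) determines the vector x of weight mu: omega is H-linear and
    invertible, so Psi(lambda, x) determines every functional f~^x, and f~^x
    takes the value f(x) at 1 (Psi_inj). The defining property of I contracts
    the composite of three such maps, attached to x, y, z, to a single one in
    two ways, according to the pair that is contracted first. By injectivity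
      (Delta (x) id)I(lambda) (I(lambda) (x) 1)
        = (id (x) Delta)I(lambda) (1 (x) I(lambda mu))
    on vectors whose first component has weight mu (fusion_cocycle). In the
    same way, taking one of the two modules to be trivial and using
    omega(id) = epsilon, both contractions of I(lambda) with epsilon are 1
    (fusion_unitl, fusion_unitr); and since I(lambda) maps a vector of weights
    (mu, eta) to one of weight mu eta, it commutes with a (x) a.

    The group A is finite and abelian and the characteristic is 0, so H is
    spanned by weight vectors and the P_mu sum to 1 (sum_Pchar). Testing on
    the vectors P_mu (x) P_eta (x) P_zeta of the regular module turns the
    relation above into the identity in H (x) H (x) H
      (Delta (x) id)I(lambda) (I(lambda) (x) 1)
        = (id (x) Delta)I(lambda) sum_mu P_mu (x) I(lambda mu)
    (fusion_pentagon). Take inverses of both sides and apply S^-1 in each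
    factor followed by the exchange of the outer factors. This map is
    antimultiplicative, exchanges Delta (x) id and id (x) Delta, sends
    I(lambda)^-1 to J(lambda) and P_mu to P_{mu^-1}: the outcome is the twist
    equation (twist_of_fusion_cocycle). The two other conditions
    are transported in the same way.

    The last step needs that S is an antihomomorphism of algebras and of
    coalgebras, and that it is bijective. All three are proved
    with the matrix C of coefficients of the regular comodule: its entries
    span H and satisfy Delta(C) = C (x) C, so that S(C) is the inverse of C
    over H. Uniqueness of inverse matrices gives the first two
    (antipodeM, comul_antipode); bijectivity follows from the
    existence of a nonzero left integral, which is obtained as a
    trace (trace_integralP, trace_integral_nonzero, antipode_epi). *)

(** * Calculus in tensor products *)

Section TensorCalculus.
Variable k : fieldType.
Implicit Types U V W : vectType k.

HB.instance Definition _ U V :=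
  bilinear_isBilinear.Build k U V (tens U V) *:%R *:%R (@tpure k U V)
    (tpure_bilin U V).

Lemma lfun_tens_ext U V W (f g : 'Hom(tens U V, W)) :
  (forall u v, f (u \ox v) = g (u \ox v)) -> f = g.
Proof.
by move=> fg; apply/lfunP; apply: tens_ext fg => c s t; rewrite linearP.
Qed.

Lemma tens_basisE U V (t : tens U V) :
  t = \sum_(i < \dim {:U}) (vbasis {:U})`_i \ox
        (\sum_(j < \dim {:V}) (t : 'M[k]_(_, _)) i j *: (vbasis {:V})`_j).
Proof.
rewrite [LHS]tens_decomp; apply: eq_bigr => i _; rewrite linear_sumr.
by apply: eq_bigr => j _; rewrite linearZr_LR.
Qed.

Definition contractl U V (f : dual U) : 'Hom(tens U V, V) :=
  linfun (tlift (fun u v => (f u : k) *: v)).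
Definition contractr U V (g : dual V) : 'Hom(tens U V, U) :=
  linfun (tlift (fun u v => (g v : k) *: u)).

Lemma contractlE U V (f : dual U) (u : U) (v : V) :
  contractl V f (u \ox v) = (f u : k) *: v.
Proof.
rewrite lfunE /= tliftE //; split=> [b|a] c s t /=.
  by rewrite linearP scalerDl scalerA.
by rewrite scalerDr !scalerA mulrC.
Qed.

Lemma contractrE U V (g : dual V) (u : U) (v : V) :
  contractr U g (u \ox v) = (g v : k) *: u.
Proof.
rewrite lfunE /= tliftE //; split=> [b|a] c s t /=.
  by rewrite scalerDr !scalerA mulrC.
by rewrite linearP scalerDl scalerA.
Qed.

Lemma contractl_tassoc U V W (f : dual U) (u : U) (s : tens V W) :
  tmap (contractl V f) \1 (tassoc U V W (u \ox s)) = (f u : k) *: s.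
Proof.
move: s; apply: tens_ext => [c s t|c s t|v w].
- by rewrite linearPr !linearP.
- by rewrite scalerDr !scalerA mulrC.
by rewrite tassocE tmapE contractlE id_lfunE linearZl_LR.
Qed.

(** Coordinates as elements of the dual space, the form that contractl takes. *)
Definition coordd U (i : 'I_(\dim {:U})) : dual U :=
  linfun (coord (vbasis {:U}) i : U -> k^o).

Lemma coorddE U i (u : U) : coordd i u = coord (vbasis {:U}) i u.
Proof. by rewrite lfunE. Qed.

(** In finite dimension the functionals p (x) q span the dual of U (x) V: a
    functional is the combination of the products of coordinate functionals
    with its own values on the basis as coefficients. *)
Lemma dual_tens_ext U V W (f g : dual (tens U V) -> W) :
    linear f -> linear g ->
  (forall p q, f (Defs.dpair p q) = g (Defs.dpair p q)) -> f =1 g.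
Proof.
move=> fl gl fg t.
pose f' : {linear dual (tens U V) -> W} := HB.pack f (GRing.isLinear.Build k _ W _ f fl).
pose g' : {linear dual (tens U V) -> W} := HB.pack g (GRing.isLinear.Build k _ W _ g gl).
have -> : t = \sum_(i < \dim {:U}) \sum_(j < \dim {:V})
    t ((vbasis {:U})`_i \ox (vbasis {:V})`_j) *: Defs.dpair (coordd i) (coordd j).
  apply: lfun_tens_ext => u v.
  rewrite [in LHS](coord_vbasis (memvf u)) [in LHS](coord_vbasis (memvf v)).
  rewrite linear_sumlz linear_sum sum_lfunE; apply: eq_bigr => i _.
  rewrite linear_sumr linear_sum sum_lfunE; apply: eq_bigr => j _.
  rewrite linearZl_LR linearZr_LR !linearZ /= scale_lfunE dpairE !coorddE.
  by rewrite /GRing.scale /= [LHS]mulrA mulrC.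
rewrite -[LHS]/(f' _) -[RHS]/(g' _) !linear_sum; apply: eq_bigr => i _.
by rewrite !linear_sum; apply: eq_bigr => j _; rewrite !linearZ /= fg.
Qed.

End TensorCalculus.

(** A left inverse of a matrix equals any right inverse. The entries
    are kept as functions of a finite type, so that pairs can serve as indices. *)
Lemma inverse_uniq (I : finType) (R : nzRingType) (l m r : I -> I -> R) :
    (forall i j, \sum_p l i p * m p j = (i == j)%:R) ->
    (forall i j, \sum_p m i p * r p j = (i == j)%:R) ->
  forall i j, l i j = r i j.
Proof.
move=> lm mr i j.
transitivity (\sum_p \sum_q l i p * m p q * r q j).
  rewrite (bigD1 j) //= [X in _ = _ + X]big1 ?addr0 => [|p /negPf pj].
    under eq_bigr do rewrite -mulrA.
    by rewrite -mulr_sumr mr eqxx mulr1.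
  under eq_bigr do rewrite -mulrA.
  by rewrite -mulr_sumr mr pj mulr0.
rewrite exchange_big /= (bigD1 i) //= -mulr_suml lm eqxx mul1r.
by rewrite big1 ?addr0 // => q /negPf qi; rewrite -mulr_suml lm eq_sym qi mul0r.
Qed.

(** * The comatrix of the regular comodule, and the antipode *)

Section Antipode.
Variables (k : fieldType) (H : hopfType k).
Local Notation e := (vbasis {:H}).
Local Notation n := (\dim {:H}).
Local Notation e_ i := (vbasis {:H})`_(i : 'I_(\dim {:H})).
Local Notation S := (@antipode k H).

(** The coefficient matrix of H as a comodule over itself, see comul_basis.
    Coassociativity is encoded once and for all in comul_comx, and the entries
    span H (comx_span), so an identity that is linear in each of its arguments
    can be checked on the entries, where comultiplication is a matrix
    product. The body is locked, since rewriting with sums would otherwise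
    unfold it. *)
Definition comx (i j : 'I_n) : H :=
  locked (\sum_l (comul (e_ j) : 'M[k]_(_, _)) i l *: (e_ l)).

Lemma comul_basis (j : 'I_n) : comul (e_ j) = \sum_(i < n) (e_ i) \ox comx i j.
Proof. by rewrite /comx; under eq_bigr do rewrite -lock; apply: tens_basisE. Qed.

Lemma coord_vbasis_delta (i j : 'I_n) : coord e i (e_ j) = (i == j)%:R.
Proof. by rewrite coord_free ?(basis_free (vbasisP _)) // eq_sym. Qed.

Lemma sum_coord_basis (W : lmodType k) (x : 'I_n -> W) i :
  \sum_j coord e i (e_ j) *: x j = x i.
Proof.
rewrite (bigD1 i) //= coord_vbasis_delta eqxx scale1r big1 ?addr0 // => j /negPf ji.
by rewrite coord_vbasis_delta eq_sym ji scale0r.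
Qed.

(** Coassociativity at the basis vector e_j, read off at the coordinate i
    of the leftmost factor. *)
Lemma comul_comx i j : comul (comx i j) = \sum_p comx i p \ox comx p j.
Proof.
have E := congr1 (tmap (contractl H (coordd i)) \1) (comulA (e_ j)).
rewrite comul_basis !linear_sum /= in E; move: E.
under [X in X = _]eq_bigr => p _.
  rewrite tmapE tmapE id_lfunE comul_basis linear_sum /=.
  under eq_bigr do rewrite contractlE coorddE.
  rewrite sum_coord_basis id_lfunE.
  over.
under [X in _ = X]eq_bigr do rewrite tmapE id_lfunE contractl_tassoc coorddE.
by rewrite sum_coord_basis.
Qed.

Lemma contractl_counit h : contractl H counit (comul h) = h.
Proof. by rewrite lfunE; apply: counitl. Qed.

Lemma contractr_counit h : contractr H counit (comul h) = h.
Proof. by rewrite lfunE; apply: counitr. Qed.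

Lemma counit_comx i j : counit (comx i j) = (i == j)%:R.
Proof.
have := contractr_counit (e_ j); rewrite comul_basis linear_sum /=.
under eq_bigr do rewrite contractrE.
move/(congr1 (coord e i)); rewrite linear_sum coord_vbasis_delta /= => <-.
under eq_bigr do rewrite linearZ /= mulrC.
exact/esym/(@sum_coord_basis k^o).
Qed.

Lemma basis_comx (j : 'I_n) : e_ j = \sum_(i < n) (counit (e_ i) : k) *: comx i j.
Proof.
rewrite -[LHS]contractl_counit comul_basis linear_sum /=.
by apply: eq_bigr => i _; rewrite contractlE.
Qed.

Lemma comx_span (h : H) :
  h = \sum_j \sum_i (coord e j h * counit (e_ i)) *: comx i j.
Proof.
rewrite [LHS](coord_vbasis (memvf h)); apply: eq_bigr => j _.
rewrite [in LHS]basis_comx scaler_sumr; apply: eq_bigr => i _.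
by rewrite scalerA.
Qed.

Lemma comx_ext (W : vectType k) (f g : 'Hom(H, W)) :
  (forall i j, f (comx i j) = g (comx i j)) -> f = g.
Proof.
move=> fg; apply/lfunP=> h; rewrite (comx_span h) !linear_sum.
apply: eq_bigr => j _; rewrite !linear_sum; apply: eq_bigr => i _.
by rewrite !linearZ /= fg.
Qed.

Lemma comx_lin_ext (W : vectType k) (f g : H -> W) : linear f -> linear g ->
  (forall i j, f (comx i j) = g (comx i j)) -> f =1 g.
Proof.
move=> fl gl fg h; rewrite -(linfunE fl) -(linfunE gl); congr (fun_of_lfun _ _).
by apply: comx_ext => i j; rewrite !linfunE.
Qed.

Lemma comx_ext2 (W : vectType k) (f g : 'Hom(tens H H, W)) :
  (forall i j p q, f (comx i j \ox comx p q) = g (comx i j \ox comx p q)) ->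
  f = g.
Proof.
move=> fg; apply: lfun_tens_ext => u v.
rewrite (comx_span u) (comx_span v) linear_sumlz !linear_sum.
apply: eq_bigr => j _; rewrite linear_sumlz !linear_sum.
apply: eq_bigr => i _; rewrite linearZl_LR linear_sumr !linearZ !linear_sum /=.
congr (_ *: _); apply: eq_bigr => q _; rewrite linear_sumr !linear_sum.
by apply: eq_bigr => p _; rewrite linearZr_LR !linearZ /= fg.
Qed.

(** For any comatrix c, that is Delta(c) = c (x) c and epsilon(c) = 1, the
    matrix S(c) is a left inverse of c, and by the next lemma a right one. *)
Lemma antipode_comatrixl (J : finType) (c : J -> J -> H) :
    (forall i j, comul (c i j) = \sum_p c i p \ox c p j) ->
    (forall i j, counit (c i j) = (i == j)%:R) ->
  forall i j, \sum_p S (c i p) * c p j = (i == j)%:R.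
Proof.
move=> cD cE i j.
have bl : bilinear_for *:%R *:%R (fun a b : H => S a * b).
  split=> [b|a] x s t /=; first by rewrite linearP mulrDl scalerAl.
  by rewrite mulrDr scalerAr.
have := antipodel (c i j).
rewrite cD cE linear_sum /= scaler_nat => <-.
by apply: eq_bigr => p _; rewrite tliftE.
Qed.

Lemma antipode_comatrixr (J : finType) (c : J -> J -> H) :
    (forall i j, comul (c i j) = \sum_p c i p \ox c p j) ->
    (forall i j, counit (c i j) = (i == j)%:R) ->
  forall i j, \sum_p c i p * S (c p j) = (i == j)%:R.
Proof.
move=> cD cE i j.
have bl : bilinear_for *:%R *:%R (fun a b : H => a * S b).
  split=> [b|a] x s t /=; last by rewrite linearP mulrDr scalerAr.
  by rewrite mulrDl scalerAl.
have := antipoder (c i j).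
rewrite cD cE linear_sum /= scaler_nat => <-.
by apply: eq_bigr => p _; rewrite tliftE.
Qed.

Definition antipode_comxl := antipode_comatrixl comul_comx counit_comx.
Definition antipode_comxr := antipode_comatrixr comul_comx counit_comx.

Lemma antipode1 : S 1 = 1.
Proof.
have c1 (i j : unit) : comul (1 : H) = \sum_(p : unit) 1 \ox 1.
  by rewrite comul1 (big_pred1 tt) // => -[].
have e1 (i j : unit) : counit (1 : H) = (i == j)%:R.
  by rewrite counit1; case: i j => [] [].
have := antipode_comatrixl c1 e1 tt tt.
by rewrite (big_pred1 tt) ?mulr1 // => -[].
Qed.

Definition mulm : 'Hom(tens H H, H) := linfun (tlift (fun a b : H => a * b)).

Lemma mulmE (a b : H) : mulm (a \ox b) = a * b.
Proof.
rewrite lfunE /= tliftE //; split=> [y|x] c s t /=.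
  by rewrite mulrDl scalerAl.
by rewrite mulrDr scalerAr.
Qed.

(** Both S(g h) and S(h) S(g) are, for entries g and h of the comatrix, the
    inverse of the comatrix of products, which is indexed by pairs. *)
Lemma antipodeM g h : S (g * h) = S h * S g.
Proof.
pose P (i : 'I_n * 'I_n) (j : 'I_n * 'I_n) := comx i.1 j.1 * comx i.2 j.2.
have deltaM (R : nzRingType) (i j : 'I_n * 'I_n) :
    (i == j)%:R = (i.1 == j.1)%:R * (i.2 == j.2)%:R :> R.
  by rewrite -natrM mulnb; case: i j => ? ? [].
have PD (i j : 'I_n * 'I_n) : comul (P i j) = \sum_q P i q \ox P q j.
  rewrite /P comulM !comul_comx mulr_suml -(pair_bigA _ (fun a b =>
     (comx i.1 a * comx i.2 b) \ox (comx a j.1 * comx b j.2))) /=.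
  apply: eq_bigr => a _; rewrite mulr_sumr; apply: eq_bigr => b _.
  by rewrite tens_mulE.
have PE (i j : 'I_n * 'I_n) : counit (P i j) = (i == j)%:R.
  by rewrite counitM !counit_comx; exact/esym/(deltaM k).
suff /comx_ext2/(congr1 (fun f : 'Hom(_, _) => f (g \ox h))) :
    forall i j p q, (S \o mulm)%VF (comx i j \ox comx p q) =
      (mulm \o tmap S S \o tflip H H)%VF (comx i j \ox comx p q).
  by rewrite !comp_lfunE tflipE tmapE !mulmE.
move=> i j p q; rewrite !comp_lfunE tflipE tmapE !mulmE.
apply: (inverse_uniq (l := fun i j => S (P i j)) (m := P)
  (r := fun i j => S (comx i.2 j.2) * S (comx i.1 j.1)) _ _ (i, p) (j, q)).
  exact: antipode_comatrixl.
move=> {i j p q} i j; rewrite deltaM -(pair_bigA _ (fun a b =>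
  P i (a, b) * (S (comx b j.2) * S (comx a j.1)))) /=.
rewrite /P /= -antipode_comxr mulr_suml; apply: eq_bigr => a _.
under eq_bigr do rewrite mulrA -[X in X * _]mulrA.
rewrite -mulr_suml -mulr_sumr antipode_comxr.
by case: eqP => _; rewrite ?mulr1 ?mulr0 ?mul0r.
Qed.

(** Both sides are, at the entries of the comatrix C, an inverse of the matrix
    Delta(C) over H (x) H. *)
Lemma comul_antipode h :
  comul (S h) = tmap S S (tflip H H (comul h)).
Proof.
suff /comx_ext/(congr1 (fun f : 'Hom(_, _) => f h)) :
    forall i j, (comul \o S)%VF (comx i j) =
      (tmap S S \o tflip H H \o comul)%VF (comx i j).
  by rewrite !comp_lfunE.
move=> i j; rewrite !comp_lfunE.
apply: (inverse_uniq (l := fun i j => comul (S (comx i j)))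
  (m := fun i j => comul (comx i j))
  (r := fun i j => tmap S S (tflip H H (comul (comx i j))))) => {i j} i j.
  under eq_bigr do rewrite -comulM.
  rewrite -linear_sum antipode_comxl.
  by case: eqP => _; rewrite ?mulr1n ?mulr0n ?linear0 /= ?comul1.
transitivity (\sum_p \sum_q \sum_l (comx i q * S (comx l j)) \ox (comx q p * S (comx p l))).
  apply: eq_bigr => p _; rewrite !comul_comx mulr_suml; apply: eq_bigr => q _.
  rewrite !linear_sum /= mulr_sumr; apply: eq_bigr => l _.
  by rewrite tflipE tmapE tens_mulE.
rewrite exchange_big.
transitivity (\sum_q (comx i q * S (comx q j)) \ox (1 : H)).
  apply: eq_bigr => q _; rewrite exchange_big (bigD1 q) //= [X in _ + X]big1 ?addr0.
    by rewrite -linear_sumr antipode_comxr eqxx.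
  by move=> l /negPf lq; rewrite -linear_sumr antipode_comxr eq_sym lq linear0r.
rewrite -linear_sumlz antipode_comxr.
by case: eqP => _; rewrite ?mulr1n ?mulr0n ?linear0l.
Qed.

Lemma counit_antipode h : counit (S h) = counit h.
Proof.
suff /comx_ext/(congr1 (fun f : 'Hom(_, _) => f h)) :
    forall i j, (counit \o S)%VF (comx i j) = counit (comx i j).
  by rewrite comp_lfunE.
move=> i j; rewrite comp_lfunE.
have := congr1 (@counit k H) (antipode_comxl i j).
rewrite linear_sum /=; under eq_bigr do rewrite counitM counit_comx.
rewrite (bigD1 j) //= eqxx mulr1 big1 ?addr0 => [->|l /negPf ->]; last by rewrite mulr0.
by rewrite counit_comx; case: eqP => _; rewrite ?mulr1n ?mulr0n ?counit1 ?linear0.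
Qed.

End Antipode.

(** * Integrals and bijectivity of the antipode *)

Section AntipodeBijective.
Variables (k : fieldType) (H : hopfType k).
Local Notation e := (vbasis {:H}).
Local Notation n := (\dim {:H}).
Local Notation e_ i := (vbasis {:H})`_(i : 'I_(\dim {:H})).
Local Notation S := (@antipode k H).

(** In Sweedler notation this is the sum over i of e^i(S^2(e_i(2)) t) e_i(1),
    where e^i is the dual basis. It is the image of the invariant vector
    (the sum of the e_i (x) e^i) of H (x) H^* under the isomorphism of
    H (x) H^* with a free H-module, evaluated at t; this is why it is
    an integral and why it cannot vanish for all t. *)
Definition trace_integral (t : H) : H :=
  \sum_i \sum_p coord e i (S (S (comx p i)) * t) *: e_ p.

Lemma antipode_sum (I : finType) (F : I -> H) : S (\sum_i F i) = \sum_i S (F i).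
Proof. exact: linear_sum. Qed.

Lemma antipode_delta (i j : 'I_n) : S ((i == j)%:R) = (i == j)%:R.
Proof. by case: eqP => _; rewrite ?mulr1n ?mulr0n ?linear0 //= antipode1. Qed.

Lemma sum_delta (W : lmodType k) (x : 'I_n -> W) i :
  \sum_j (i == j)%:R *: x j = x i.
Proof.
by under eq_bigr do rewrite -coord_vbasis_delta; apply: sum_coord_basis.
Qed.

Lemma mulr_delta (x : H) (b : bool) : b%:R * x = (b%:R : k) *: x.
Proof. by case: b; rewrite ?mul1r ?scale1r // mul0r scale0r. Qed.

(** With h = h(1) and its further components: inserting S(h(3)) S^2(h(2)), which
    is S(S(h(2)) h(3)) = epsilon, writes h e_i(1) (x) S^2(e_i(2)) through the
    comultiplication of h(1) e_i; then cyclicity of the trace moves h(1)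
    next to S(h(2)), and the two cancel. *)
Lemma trace_integralP t h : h * trace_integral t = (counit h : k) *: trace_integral t.
Proof.
move: h; apply: comx_lin_ext => [c x y|c x y|a b].
- by rewrite mulrDl scalerAl.
- by rewrite linearP scalerDl scalerA.
rewrite counit_comx.
pose T i y : 'Hom(tens H H, H) :=
  linfun (tlift (fun u v => coord e i (y * S (S v) * t) *: u)).
have TE i y u v : T i y (u \ox v) = coord e i (y * S (S v) * t) *: u.
  rewrite lfunE /= tliftE //; split=> [v'|u'] c p q /=.
    by rewrite scalerDr !scalerA mulrC.
  by rewrite !linearP /= mulrDr mulrDl -scalerAr -scalerAl linearP scalerDl scalerA.
(* The insertion of S(h(3)) S^2(h(2)); the sum over d removes it again. *)
transitivity (\sum_d \sum_i T i (S (comx d b)) (comul (comx a d * e_ i))).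
  rewrite exchange_big /trace_integral mulr_sumr; apply: eq_bigr => i _.
  transitivity (\sum_d \sum_l \sum_p
     coord e i (S (S (comx l d) * comx d b) * (S (S (comx p i)) * t)) *: (comx a l * e_ p)).
    rewrite exchange_big.
    transitivity (\sum_l (b == l)%:R *: (comx a l * (\sum_p coord e i (S (S (comx p i)) * t) *: e_ p))).
      by rewrite sum_delta.
    apply: eq_bigr => l _; rewrite exchange_big mulr_sumr scaler_sumr.
    apply: eq_bigr => p _; rewrite -scaler_suml -linear_sum -mulr_suml -antipode_sum.
    by rewrite antipode_comxl antipode_delta mulr_delta linearZ /= eq_sym -scalerAr scalerA.
  apply: eq_bigr => d _; rewrite comulM comul_comx comul_basis mulr_suml linear_sum /=.
  apply: eq_bigr => l _; rewrite mulr_sumr linear_sum /=; apply: eq_bigr => p _.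
  by rewrite tens_mulE TE !antipodeM !mulrA.
(* Cyclicity of the trace: comx a d * e_ i is expanded in the basis, and the
   sum over i is contracted first. *)
transitivity (\sum_d \sum_m \sum_q
    coord e m (comx a d * S (comx d b) * (S (S (comx q m)) * t)) *: e_ q).
  apply: eq_bigr => d _.
  transitivity (\sum_i \sum_m coord e m (comx a d * e_ i) *: T i (S (comx d b)) (comul (e_ m))).
    apply: eq_bigr => i _; rewrite [in LHS](coord_vbasis (memvf (_ * _))).
    by rewrite !linear_sum; apply: eq_bigr => m _; rewrite !linearZ.
  rewrite exchange_big; apply: eq_bigr => m _.
  transitivity (\sum_i \sum_q coord e m (comx a d * e_ i) *:
      (coord e i (S (comx d b) * (S (S (comx q m)) * t)) *: e_ q)).
    apply: eq_bigr => i _; rewrite comul_basis linear_sum scaler_sumr /=.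
    by apply: eq_bigr => q _; rewrite TE mulrA.
  rewrite exchange_big; apply: eq_bigr => q _.
  under eq_bigr do rewrite scalerA mulrC.
  rewrite -scaler_suml; congr (_ *: _).
  rewrite -[in RHS]mulrA [in RHS](coord_vbasis (memvf (S (comx d b) * _))).
  rewrite mulr_sumr linear_sum; apply: eq_bigr => i _.
  by rewrite -scalerAr linearZ.
rewrite exchange_big scaler_sumr; apply: eq_bigr => m _.
rewrite exchange_big scaler_sumr; apply: eq_bigr => q _.
rewrite -scaler_suml -linear_sum -mulr_suml antipode_comxr mulr_delta linearZ /=.
by rewrite scalerA.
Qed.

(** If all trace integrals vanish, then so does, for each p and t, the
    sum over i of e^i(S^2(C p i) t). Taking t = S(C q p) and summing over
    p, the factors combine to S of the (q, i) entry of C S(C), so that e^q(1) = 0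
    for all q, which is absurd. *)
Lemma trace_integral_nonzero : (forall t, trace_integral t = 0) -> False.
Proof.
move=> L0.
have L0p p t : \sum_i coord e i (S (S (comx p i)) * t) = 0.
  have := L0 t; rewrite /trace_integral exchange_big /=.
  under eq_bigr do rewrite -scaler_suml.
  move/(congr1 (coord e p)); rewrite linear_sum linear0 /= => E0.
  apply: etrans E0; under [RHS]eq_bigr do rewrite linearZ /= mulrC.
  exact/esym/(@sum_coord_basis k H k^o).
have /eqP := oner_neq0 H; apply.
rewrite [LHS](coord_vbasis (memvf 1)) big1 // => q _.
suff -> : coord e q 1 = 0 by rewrite scale0r.
transitivity (\sum_i coord e i ((q == i)%:R : H)).
  under eq_bigr do rewrite -[X in coord _ _ X]mulr1 mulr_delta linearZ.
  by rewrite (@sum_delta k^o).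
transitivity (\sum_i \sum_p coord e i (S (S (comx p i)) * S (comx q p))).
  apply: eq_bigr => i _; rewrite -antipode_delta -antipode_comxr antipode_sum.
  by rewrite linear_sum; apply: eq_bigr => p _; rewrite antipodeM.
by rewrite exchange_big big1.
Qed.

(** Let L be a left integral. Then L(1) (x) S(L(2)) x = x L(1) (x) S(L(2)), so
    phi o S = 0 implies L(1) phi(S(L(2)) x) = 0 for all x. Splitting L(1) further
    and taking x = S^2(L(2)) h, the product S(L(3)) S^2(L(2)) collapses and leaves
    phi(h) L = 0. As some L is nonzero, phi = 0. Below, Delta(L) is the sum of
    the e_i (x) y_i. *)
Lemma antipode_epi (W : vectType k) (phi : 'Hom(H, W)) :
  (phi \o S)%VF = 0 -> phi = 0.
Proof.
move=> phiS; apply/eqP; apply: contraT => phi_neq0; exfalso.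
apply: trace_integral_nonzero => t; set L := trace_integral t.
pose x j := coord e j L; pose y i := \sum_j x j *: comx i j.
have LD : comul L = \sum_i e_ i \ox y i.
  rewrite [in LHS](coord_vbasis (memvf L)) linear_sum /=.
  under eq_bigr do rewrite linearZ /= comul_basis scaler_sumr.
  rewrite exchange_big; apply: eq_bigr => i _; rewrite linear_sumr.
  by apply: eq_bigr => j _; rewrite linearZr_LR.
have yS p : \sum_i S (comx p i) * y i = (x p)%:A.
  rewrite /y; under eq_bigr do rewrite mulr_sumr.
  rewrite exchange_big /=; under eq_bigr => j _.
    under eq_bigr do rewrite -scalerAr.
    rewrite -scaler_sumr antipode_comxl -[_%:R]mulr1 mulr_delta scalerA mulrC -scalerA.
    over.
  by rewrite sum_delta.
have swap a b : \sum_i (comx a b * e_ i) \ox phi (S (y i)) =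
                \sum_i e_ i \ox phi (S (y i) * comx a b).
  pose T (c : H) : 'Hom(tens H H, tens H W) := tmap \1 (phi \o amulr c \o S)%VF.
  have TE c u v : T c (u \ox v) = u \ox phi (S v * c).
    by rewrite tmapE id_lfunE !comp_lfunE lfunE.
  transitivity (\sum_d T (comx d b) (comul (comx a d * L))).
    transitivity (\sum_d \sum_l \sum_i (comx a l * e_ i) \ox
        phi (S (y i) * (S (comx l d) * comx d b))).
      rewrite exchange_big.
      transitivity (\sum_l (b == l)%:R *: \sum_i (comx a l * e_ i) \ox phi (S (y i))).
        by rewrite sum_delta.
      apply: eq_bigr => l _; rewrite exchange_big scaler_sumr; apply: eq_bigr => i _.
      rewrite -linear_sumr -linear_sum -mulr_sumr antipode_comxl eq_sym.
      by case: eqP => _; rewrite ?scale1r ?mulr1 // scale0r mulr0 linear0 linear0r.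
    apply: eq_bigr => d _; rewrite comulM comul_comx LD mulr_suml linear_sum /=.
    apply: eq_bigr => l _; rewrite mulr_sumr linear_sum /=; apply: eq_bigr => i _.
    by rewrite tens_mulE TE antipodeM mulrA.
  transitivity (\sum_d (a == d)%:R *: T (comx d b) (comul L)).
    by apply: eq_bigr => d _; rewrite trace_integralP counit_comx !linearZ.
  by rewrite sum_delta LD linear_sum; apply: eq_bigr => i _; rewrite /= TE.
have phiSy z : phi (S z) = 0.
  by rewrite -[LHS](comp_lfunE phi S z) phiS zero_lfunE.
have phiy0 i h : phi (S (y i) * h) = 0.
  move: h; apply: (comx_lin_ext (g := fun=> 0)) => [c u v|c u v|a c].
  - by rewrite mulrDr -scalerAr linearP.
  - by rewrite scaler0 addr0.
  have /(congr1 (contractl W (coordd i))) := swap a c.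
  rewrite big1 ?linear0 => [|l _]; last by rewrite phiSy linear0r.
  rewrite linear_sum /=; under eq_bigr do rewrite contractlE coorddE.
  by rewrite sum_coord_basis.
rewrite [LHS](coord_vbasis (memvf L)) big1 // => p _.
suff xp0 : x p *: phi = 0.
  have := xp0; move/eqP; rewrite scaler_eq0 (negPf phi_neq0) orbF => /eqP.
  by rewrite /x => ->; rewrite scale0r.
apply/lfunP=> h; rewrite scale_lfunE zero_lfunE -linearZ /=.
have -> : x p *: h = \sum_i S (y i) * (S (S (comx p i)) * h).
  under eq_bigr do rewrite mulrA -antipodeM.
  by rewrite -mulr_suml -antipode_sum yS linearZ /= antipode1 -scalerAl mul1r.
by rewrite linear_sum big1 // => i _; apply: phiy0.
Qed.

(** A projection with kernel the image of S vanishes on that image, so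
    it is zero and S is onto; in finite dimension S is then also injective. *)
Lemma lker_antipode : lker S == 0%VS.
Proof.
have LS : limg S = fullv.
  apply/eqP; rewrite eqEsubv subvf; apply/subvP=> h _.
  have : (\1 - projv (limg S))%VF = 0 :> 'End(H).
    apply: antipode_epi; apply/lfunP=> z.
    rewrite comp_lfunE add_lfunE opp_lfunE id_lfunE zero_lfunE projv_id ?subrr //.
    by rewrite memv_img ?memvf.
  move/lfunP/(_ h); rewrite add_lfunE opp_lfunE id_lfunE zero_lfunE => /eqP.
  by rewrite subr_eq0 => /eqP ->; apply: memv_proj.
have := limg_ker_dim S fullv; rewrite LS capfv.
by rewrite -[in RHS](add0n (\dim _)) => /eqP; rewrite eqn_add2r dimv_eq0.
Qed.

Lemma antipodeK : cancel S (antipodeV H).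
Proof. exact/lker0_lfunK/lker_antipode. Qed.

Lemma antipodeVK : cancel (antipodeV H) S.
Proof. exact/lker0_lfunVK/lker_antipode. Qed.

Local Notation SV := (antipodeV H).

Lemma antipodeV1 : SV 1 = 1.
Proof. by rewrite -{1}antipode1 antipodeK. Qed.

Lemma antipodeVM g h : SV (g * h) = SV h * SV g.
Proof. by rewrite -{1}(antipodeVK g) -{1}(antipodeVK h) -antipodeM antipodeK. Qed.

Lemma counit_antipodeV h : counit (SV h) = counit h.
Proof. by rewrite -counit_antipode antipodeVK. Qed.

Lemma comul_antipodeV h : comul (SV h) = tmap SV SV (tflip H H (comul h)).
Proof.
rewrite -[in RHS](antipodeVK h) comul_antipode.
have : (tmap SV SV \o tflip H H \o tmap S S \o tflip H H)%VF = \1%VF.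
  apply: lfun_tens_ext => u v; rewrite !comp_lfunE id_lfunE.
  by rewrite !(tflipE, tmapE) !antipodeK.
by move/lfunP/(_ (comul (SV h))); rewrite !comp_lfunE id_lfunE => ->.
Qed.

End AntipodeBijective.

(** * Characters and the weight decomposition of H *)

(** 'X^N - 1 is separable because N is invertible in k, so each matrix is
    diagonalizable, and commuting diagonalizable matrices are diagonalizable in
    one basis. The power is an iterated product because square matrices form
    a nontrivial ring only in positive size. *)
Lemma codiagonalizable_torsion (k : closedFieldType) n N (Ms : seq 'M[k]_n) :
    N%:R != 0 :> k -> {in Ms &, forall A B, comm_mx A B} ->
    {in Ms, forall M, iter N (mulmx M) 1%:M = 1%:M} ->
  exists2 P : 'M[k]_n, P \in unitmx &
    {in Ms, forall M, exists d : 'I_n -> k,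
       forall i, row i P *m M = d i *: row i P}.
Proof.
move=> N0 MsC MsN; suff /codiagonalizableP : codiagonalizable Ms.
  move/codiagonalizableP => [P Pu /allP MsD]; exists P => // M /MsD /=.
  move=> /(diagonalizable_forP _ Pu) D; exists (fun i => (P *m M *m invmx P) i i) => i.
  have -> : row i P *m M = row i ((P *m M *m invmx P) *m P).
    by rewrite mulmxKV // row_mul.
  apply/rowP=> j; rewrite !mxE (bigD1 i) //= big1 ?addr0 ?mxE //.
  by move=> l li; rewrite D ?mul0r // eq_sym.
apply/codiagonalizableP; split=> // M /MsN.
case: n => [|n] in Ms MsC MsN M *.
  by move=> _; rewrite (flatmx0 M); exact: diagonalizable0.
move=> MN; apply/diagonalizableP.
have [rs Ers] := closed_field_poly_normal ('X^N - 1 : {poly k}).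
have Ngt0 : (0 < N)%N by rewrite lt0n; apply: contraNneq N0 => ->.
rewrite lead_coefXnsubC // scale1r in Ers; exists rs.
  by rewrite -separable_prod_XsubC -Ers separable_Xn_sub_1.
rewrite -Ers; apply: mxminpoly_min.
rewrite rmorphB rmorphXn /= horner_mx_X rmorph1.
suff -> : M ^+ N = iter N (mulmx M) 1%:M by rewrite MN subrr.
by elim: (N) => //= m IH; rewrite exprS IH.
Qed.

Section Characters.
Variables (k : closedFieldType) (A : finGroupType).
Local Notation Ahat := (charT k A).
Implicit Types mu nu : Ahat.

Lemma char_neq0 mu a : mu a != 0.
Proof.
apply: contra_eq_neq (Defs.char1 mu) => mua.
by rewrite -(mulgV a) Defs.charM mua mul0r eq_sym oner_neq0.
Qed.

Lemma charV mu a : mu a^-1%g = (mu a)^-1.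
Proof.
by apply: (mulfI (char_neq0 mu a)); rewrite -Defs.charM mulgV Defs.char1 mulfV ?char_neq0.
Qed.

Lemma charT_mulE mu nu a : (mu * nu)%g a = mu a * nu a.
Proof. by rewrite ffunE. Qed.

Lemma charT_invE mu a : (mu^-1)%g a = (mu a)^-1.
Proof. by rewrite ffunE. Qed.

Lemma charT_oneE a : (1%g : Ahat) a = 1.
Proof. by rewrite ffunE. Qed.

(** The sum is unchanged by multiplication with mu b, for any b. *)
Lemma char_sum_eq0 mu : mu != 1%g -> \sum_a mu a = 0.
Proof.
move=> mu1; have [b mub] : exists b, mu b != 1.
  apply/existsP; apply: contraNT mu1 => /existsPn mu1.
  by apply/eqP/val_inj/ffunP=> a; rewrite ffunE; apply/eqP/negbNE/mu1.
apply/eqP; have /eqP : mu b * \sum_a mu a = \sum_a mu a.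
  rewrite mulr_sumr [RHS](reindex (mulg b)) /=.
    by apply: eq_bigr => a _; rewrite Defs.charM.
  by exists (mulg b^-1) => a _; rewrite ?mulKg ?mulKVg.
by rewrite -subr_eq0 -[X in _ - X]mul1r -mulrBl mulf_eq0 subr_eq0 (negPf mub).
Qed.

End Characters.

Section WeightDecomposition.
Import VectorInternalTheory.
Variables (k : closedFieldType) (char0 : [pchar k] =i pred0).
Variables (H : hopfType k) (A : finGroupType) (abelianA : abelian [set: A]).
Variables (iota : A -> H) (iota_sub : grouplike_subgroup iota).
Local Notation Ahat := (charT k A).
Local Notation Pc := (Pchar iota).
Implicit Types mu nu : Ahat.

Lemma iota1 : iota 1%g = 1. Proof. by case: iota_sub. Qed.
Lemma iotaM a b : iota (a * b)%g = iota a * iota b.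
Proof. by case: iota_sub. Qed.
Lemma comul_iota a : comul (iota a) = iota a \ox iota a.
Proof. by case: iota_sub => _ /(_ a)[]. Qed.

Lemma counit_iota a : counit (iota a) = 1.
Proof.
have := contractl_counit (iota a); rewrite comul_iota contractlE.
move/eqP; rewrite -subr_eq0 -[X in _ - X]scale1r -scalerBl scaler_eq0 subr_eq0.
by case: iota_sub => _ /(_ a)[/eqP/negPf -> _] _ _; rewrite orbF => /eqP.
Qed.

Lemma antipode_iota a : antipode (iota a) = iota a^-1%g.
Proof.
have c1 (i j : unit) : comul (iota a) = \sum_(p : unit) iota a \ox iota a.
  by rewrite comul_iota (big_pred1 tt) // => -[].
have e1 (i j : unit) : counit (iota a) = (i == j)%:R.
  by rewrite counit_iota; case: i j => [] [].
have := antipode_comatrixl c1 e1 tt tt.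
rewrite (big_pred1 tt) => [E|[]//].
by rewrite -[LHS]mulr1 -iota1 -(mulgV a) iotaM mulrA E mul1r.
Qed.

Lemma antipodeV_iota a : antipodeV H (iota a) = iota a^-1%g.
Proof. by rewrite -{1}(invgK a) -(antipode_iota a^-1) antipodeK. Qed.

Lemma cardA_neq0 : #|A|%:R != 0 :> k.
Proof.
by rewrite ((pcharf0P k).1 char0) -lt0n; apply/card_gt0P; exists 1%g.
Qed.

Lemma iota_Pchar mu a : iota a * Pc mu = mu a *: Pc mu.
Proof.
rewrite /Pchar -scalerAr scalerA mulrC -scalerA; congr (_ *: _).
rewrite mulr_sumr scaler_sumr [RHS](reindex (mulg a)) /=.
  apply: eq_bigr => b _; rewrite -scalerAr -iotaM scalerA invMg Defs.charM.
  by rewrite !charV mulrCA mulfV ?char_neq0 ?mulr1.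
by exists (mulg a^-1) => b _; rewrite ?mulKg ?mulKVg.
Qed.

Lemma Pchar_weight mu nu (v : H) :
  (forall a, iota a * v = nu a *: v) -> Pc mu * v = (mu == nu)%:R *: v.
Proof.
move=> vw; rewrite /Pchar -scalerAl mulr_suml.
under eq_bigr do rewrite -scalerAl vw scalerA charV -charT_invE -charT_mulE.
rewrite -scaler_suml scalerA; congr (_ *: _).
have [->|mn] := eqVneq mu nu.
  under eq_bigr do rewrite mulVg charT_oneE.
  by rewrite sumr_const -mulr_natr mul1r mulVf ?cardA_neq0.
rewrite char_sum_eq0 ?mulr0 //; apply: contraNneq mn => /eqP.
by rewrite -eq_invg_mul invgK eq_sym => /eqP ->.
Qed.

(** The left multiplications by elements of A on H commute and have
    finite order, so they share an eigenbasis. The eigenvalues on a common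
    eigenvector form a character, hence the sum of the P_mu fixes each vector
    of the eigenbasis, and so it fixes 1. *)
Lemma sum_Pchar : \sum_mu Pc mu = 1.
Proof.
pose M a : 'M[k]_(dim H) := lin1_mx (v2r \o amull (iota a) \o r2v).
have ME a u : u *m M a = v2r (iota a * r2v u) by rewrite mul_rV_lin1 /= lfunE.
have MM a b : M a *m M b = M (b * a)%g.
  apply/row_matrixP=> i; rewrite row_mul !rowE !ME v2rK iotaM mulrA //.
have M1 : M 1%g = 1%:M.
  by apply/row_matrixP=> i; rewrite !rowE ME mulmx1 iota1 mul1r r2vK.
have [] := @codiagonalizable_torsion k _ #|A| (codom M) cardA_neq0.
- move=> _ _ /codomP[a ->] /codomP[b ->]; rewrite /comm_mx !MM; congr M.
  by apply: (centsP abelianA); rewrite inE.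
- move=> _ /codomP[a ->]; have aA : (a ^+ #|A| = 1)%g.
    by rewrite -cardsT; apply: expg_cardG; rewrite inE.
  rewrite -M1 -[in RHS]aA; elim: #|A| => [|m IH] //=.
  by rewrite IH MM expgSr.
move=> P Pu Pd; pose v i := r2v (row i P).
have v1 : 1 = \sum_i (v2r 1 *m invmx P) 0 i *: v i :> H.
  apply: v2r_inj; rewrite -[LHS](mulmxKV Pu) mulmx_sum_row linear_sum /=.
  by apply: eq_bigr => i _; rewrite linearZ /= r2vK.
have vP i : exists nu, forall a, iota a * v i = nu a *: v i.
  have vn0 : v i != 0.
    apply/eqP=> /(congr1 v2r); rewrite r2vK linear0 => Pi0.
    have /eqP := congr1 (fun B => row i (B : 'M[k]_(dim H))) (mulmxV Pu).
    rewrite row_mul Pi0 mul0mx => /eqP/rowP/(_ i); rewrite !mxE eqxx => /eqP.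
    by rewrite eq_sym oner_eq0.
  have da a : exists c, iota a * v i == c *: v i.
    have [d Dd] := Pd _ (codom_f M a); exists (d i); apply/eqP/v2r_inj.
    by rewrite -ME Dd linearZ /= r2vK.
  pose f := [ffun a => xchoose (da a)].
  have fE a : iota a * v i = f a *: v i by rewrite ffunE; apply/eqP/(xchooseP (da a)).
  have vI (c d : k) : c *: v i = d *: v i -> c = d.
    move/eqP; rewrite -subr_eq0 -scalerBl scaler_eq0 (negPf vn0) orbF subr_eq0.
    by move/eqP.
  have fc : is_char f.
    apply/andP; split.
      by apply/eqP/vI; rewrite -fE iota1 mul1r scale1r.
    apply/'forall_forallP => a b; apply/eqP/vI.
    by rewrite -fE iotaM -mulrA fE -scalerAr fE scalerA mulrC.
  by exists (CharT fc) => a; rewrite fE.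
rewrite -[LHS]mulr1 [in RHS]v1 [in LHS]v1 mulr_sumr; apply: eq_bigr => i _.
rewrite -scalerAr; congr (_ *: _); have [nu nuP] := vP i.
rewrite mulr_suml (bigD1 nu) //= (Pchar_weight _ nuP) eqxx scale1r.
by rewrite big1 ?addr0 // => mu /negPf mn; rewrite (Pchar_weight _ nuP) mn scale0r.
Qed.

Lemma PcharM mu nu : Pc mu * Pc nu = (mu == nu)%:R *: Pc nu.
Proof. by apply: Pchar_weight => a; apply: iota_Pchar. Qed.

Lemma antipodeV_Pchar mu : antipodeV H (Pc mu) = Pc mu^-1%g.
Proof.
rewrite /Pchar linearZ linear_sum /=; congr (_ *: _).
rewrite [RHS](reindex invg) /=; last by exists invg => a _; rewrite invgK.
apply: eq_bigr => a _; rewrite linearZ /= antipodeV_iota charT_invE.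
by rewrite invgK charV.
Qed.

End WeightDecomposition.

(** * Tensor products of modules and the trivial module *)

Section TensorModules.
Variables (k : fieldType) (H : hopfType k).
Implicit Types X Y Z : fdmod H.

Lemma mact_tensmod X Y (h : H) : Defs.mact (tensmod X Y) h = tact X Y (comul h).
Proof. by rewrite comp_lfunE. Qed.

Lemma mact_tensmod_comx X Y (i j : 'I_(\dim {:H})) :
  Defs.mact (tensmod X Y) (comx i j) =
  \sum_p tmap (Defs.mact X (comx i p)) (Defs.mact Y (comx p j)).
Proof.
rewrite mact_tensmod comul_comx linear_sum; apply: eq_bigr => p _.
exact: tactE.
Qed.

Lemma mact_linear X (x : X) : linear (fun h : H => Defs.mact X h x).
Proof. by move=> c g h; rewrite linearP add_lfunE scale_lfunE. Qed.

(** Coassociativity, as the statement that the associativity isomorphism of a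
    triple tensor product is H-linear. *)
Lemma tassoc_hom X Y Z (h : H) (z : tens X (tens Y Z)) :
  Defs.mact (tensmod (tensmod X Y) Z) h (tassoc X Y Z z) =
  tassoc X Y Z (Defs.mact (tensmod X (tensmod Y Z)) h z).
Proof.
move: z; apply: tens_ext => [c s t|c s t|x s]; try by rewrite !linearP.
move: s; apply: tens_ext => [c s t|c s t|y z]; try by rewrite linearPr !linearP.
move: h; apply: comx_lin_ext => [||i j].
- exact: mact_linear.
- by move=> c g h; rewrite mact_linear linearP.
rewrite !mact_tensmod_comx !sum_lfunE linear_sum /= tassocE.
transitivity (\sum_p \sum_q Defs.mact X (comx i q) x \ox Defs.mact Y (comx q p) y
                              \ox Defs.mact Z (comx p j) z).
  apply: eq_bigr => p _; rewrite tmapE mact_tensmod_comx sum_lfunE.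
  by rewrite linear_sumlz; apply: eq_bigr => q _; rewrite tmapE.
rewrite exchange_big; apply: eq_bigr => p _.
rewrite tmapE mact_tensmod_comx sum_lfunE linear_sumr linear_sum /=.
by apply: eq_bigr => q _; rewrite tmapE tassocE.
Qed.

Lemma dpair_tassoc X Y Z (f : dual X) (g : dual Y) (h : dual Z) :
  (Defs.dpair (Defs.dpair f g) h \o tassoc X Y Z)%VF = Defs.dpair f (Defs.dpair g h).
Proof.
apply: lfun_tens_ext => x s; rewrite comp_lfunE.
move: s; apply: tens_ext => [c s t|c s t|y z]; try by rewrite linearPr !linearP.
by rewrite tassocE !dpairE mulrA.
Qed.

Fact trivmod_act_linear : linear (fun h : H => (counit h : k) *: (\1%VF : 'End(k^o))).
Proof. by move=> c g h; rewrite linearP scalerDl scalerA. Qed.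
Definition trivmod_act := linfun (fun h : H => (counit h : k) *: (\1%VF : 'End(k^o))).
Fact trivmod_actE h : trivmod_act h = (counit h : k) *: \1%VF.
Proof. exact: (linfunE trivmod_act_linear). Qed.
Fact trivmod_act1 : trivmod_act 1 = \1%VF.
Proof. by rewrite trivmod_actE counit1 scale1r. Qed.
Fact trivmod_actM a b : trivmod_act (a * b) = (trivmod_act a \o trivmod_act b)%VF.
Proof.
rewrite !trivmod_actE counitM; apply/lfunP=> x.
by rewrite comp_lfunE !scale_lfunE !id_lfunE scalerA.
Qed.
Definition trivmod : fdmod H := FdMod trivmod_act1 trivmod_actM.

Definition unitv : trivmod := (1 : k^o).

Lemma mact_trivmod h : Defs.mact trivmod h unitv = (counit h : k) *: unitv.
Proof. by rewrite /= trivmod_actE scale_lfunE id_lfunE. Qed.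

Lemma mact_tens_trivr X (x : X) (h : H) :
  Defs.mact (tensmod X trivmod) h (x \ox unitv) = Defs.mact X h x \ox unitv.
Proof.
move: h; apply: comx_lin_ext => [||i j]; first exact: mact_linear.
  by move=> c g h; rewrite mact_linear linearPl.
rewrite mact_tensmod_comx sum_lfunE (bigD1 j) //= big1 ?addr0.
  by rewrite tmapE mact_trivmod counit_comx eqxx scale1r.
by move=> p /negPf pj; rewrite tmapE mact_trivmod counit_comx pj scale0r linear0r.
Qed.

Lemma mact_tens_trivl X (x : X) (h : H) :
  Defs.mact (tensmod trivmod X) h (unitv \ox x) = unitv \ox Defs.mact X h x.
Proof.
move: h; apply: comx_lin_ext => [||i j]; first exact: mact_linear.
  by move=> c g h; rewrite mact_linear linearPr.
rewrite mact_tensmod_comx sum_lfunE (bigD1 i) //= big1 ?addr0.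
  by rewrite tmapE mact_trivmod counit_comx eqxx scale1r.
move=> p /negPf pj; rewrite tmapE mact_trivmod counit_comx eq_sym pj scale0r.
by rewrite linear0l.
Qed.

Lemma convl_counit : convl (counit : dual H) = \1%VF.
Proof.
apply/lfunP=> xi; rewrite convlE id_lfunE; apply: comx_ext => i j.
rewrite comp_lfunE comul_comx linear_sum /= (bigD1 i) //= big1 ?addr0.
  by rewrite dpairE counit_comx eqxx mul1r.
by move=> p /negPf pj; rewrite dpairE counit_comx eq_sym pj mul0r.
Qed.

(** epsilon is the unit of the convolution algebra, so that epsilon (x) id acts
    as the identity of H^* (x) V, which is K-linear. *)
Lemma Stab_stab_id (K : comodAlg H) (V : fdmod K) : Stab (stab_id V).
Proof.
exists ((counit : dual H) \ox (\1%VF : 'End(V))) => // c.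
have -> : yzL ((counit : dual H) \ox (\1%VF : 'End(V))) = \1%VF.
  rewrite yzLE convl_counit; apply: lfun_tens_ext => u v.
  by rewrite tmapE !id_lfunE.
by rewrite comp_lfun1l comp_lfun1r.
Qed.

End TensorModules.

(** * The maps Psi and the relations satisfied by I *)

Section Fusion.
Variables (k : closedFieldType) (H : hopfType k) (A : finGroupType).
Variables (iota : A -> H) (iota_sub : grouplike_subgroup iota).
Variables (K : comodAlg H) (V : charT k A -> fdmod K).
Variables (om : forall lambda mu : charT k A,
     'Hom(H, 'Hom(V lambda, V mu)) -> dual H).
Variables (omV : forall lambda mu : charT k A,
     dual H -> 'Hom(H, 'Hom(V lambda, V mu))).
Hypothesis om_iso : forall lambda mu : charT k A,
     Hiso (@Stab k H K (V lambda) (V mu)) (Cmu iota (lambda * mu^-1)%g)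
          (@om lambda mu) (omV lambda mu).
Hypothesis om_id : forall lambda : charT k A,
     @om lambda lambda (stab_id (V lambda)) = counit.
Implicit Types lambda kappa rho mu eta : charT k A.
Implicit Types X Y Z : fdmod H.

Lemma ftilde_linear X (x : X) : linear (ftilde x).
Proof.
by move=> c f g; apply/lfunP=> h; rewrite !(ftildeE, add_lfunE, scale_lfunE).
Qed.

(** In this section kappa and rho stand for products of characters, tied to
    them by equations: V is a family indexed by characters, and equal but not
    identical indices would otherwise require transport between its members. *)
Lemma ftilde_Cmu lambda kappa mu X (x : X) f :
  (lambda * mu)%g = kappa -> weight iota mu x ->
  Cmu iota (lambda * kappa^-1)%g (ftilde x f).
Proof.
move=> <- xmu a h; rewrite !ftildeE antipodeM (antipode_iota iota_sub) mactM.
have -> : (lambda * (lambda * mu)^-1)%g a = mu a^-1%g.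
  by rewrite charV charT_mulE charT_invE charT_mulE invfM mulVKf ?char_neq0.
by rewrite comp_lfunE xmu !linearZ.
Qed.

Lemma hactE (W : vectType k) h (G : 'Hom(H, W)) t : hact h G t = G (t * h).
Proof. by rewrite comp_lfunE lfunE. Qed.

Lemma hact_ftilde X (x : X) f h :
  hact h (ftilde x f) = ftilde x (f \o Defs.mact X (antipode h))%VF.
Proof.
by apply/lfunP=> t; rewrite hactE !ftildeE antipodeM mactM !comp_lfunE.
Qed.

Lemma PsiE lambda kappa mu X (x : X) f u :
  (lambda * mu)%g = kappa -> weight iota mu x ->
  Psi (omV lambda kappa) x (f \ox u) = omV lambda kappa (ftilde x f) 1 u.
Proof.
move=> lk xmu; have [_ [_ omVl _] _ _] := om_iso lambda kappa.
rewrite lfunE /= tliftE //; split=> [v|g] c s t /=; last by rewrite linearP.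
by rewrite ftilde_linear omVl; try exact: ftilde_Cmu xmu;
  rewrite !(add_lfunE, scale_lfunE).
Qed.

(** By H-linearity of the inverse of omega, the value at h of the function
    attached to f~^x is its value at 1 after replacing f with f o S(h). So
    Psi(lambda, x) determines this function, hence f~^x, for every f; and
    f~^x(1) = f(x). *)
Lemma Psi_inj lambda kappa mu X (x y : X) :
  (lambda * mu)%g = kappa -> weight iota mu x -> weight iota mu y ->
  Psi (omV lambda kappa) x = Psi (omV lambda kappa) y -> x = y.
Proof.
move=> lk xmu ymu xy; have [_ [_ _ omVh] _ omVK] := om_iso lambda kappa.
have C z f : weight iota mu z -> Cmu iota (lambda * kappa^-1)%g (@ftilde _ _ X z f).
  exact: ftilde_Cmu.
have omE f : omV lambda kappa (ftilde x f) = omV lambda kappa (ftilde y f).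
  apply/lfunP=> h; apply/lfunP=> u.
  have E z : weight iota mu z -> omV lambda kappa (ftilde z f) h u =
      Psi (omV lambda kappa) z ((f \o Defs.mact X (antipode h))%VF \ox u).
    move=> zmu; rewrite (PsiE _ _ lk) // -hact_ftilde omVh ?hactE ?mul1r //.
    exact: C.
  by rewrite !E // xy.
have fE (f : dual X) : f x = f y.
  have := congr1 (@om lambda kappa) (omE f).
  rewrite !omVK; try exact: C.
  by move/lfunP/(_ 1); rewrite !ftildeE antipode1 !mact1 !id_lfunE.
rewrite (coord_vbasis (memvf x)) (coord_vbasis (memvf y)).
apply: eq_bigr => i _; congr (_ *: _).
by have := fE (coordd i); rewrite !coorddE.
Qed.

Lemma Psi_tens_inj lambda kappa mu X Y (x y : tensmod X Y) :
  (lambda * mu)%g = kappa -> weight iota mu x -> weight iota mu y ->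
  (forall f g u, Psi (omV lambda kappa) x (Defs.dpair f g \ox u) =
                 Psi (omV lambda kappa) y (Defs.dpair f g \ox u)) -> x = y.
Proof.
move=> lk xmu ymu xy; apply: (Psi_inj lk xmu ymu).
apply: lfun_tens_ext => f u; move: f.
by apply: dual_tens_ext => [c f g|c f g|f g]; rewrite ?linearPl ?linearP.
Qed.

Lemma Psi_tens3_inj lambda kappa mu X Y Z (x y : tensmod (tensmod X Y) Z) :
  (lambda * mu)%g = kappa -> weight iota mu x -> weight iota mu y ->
  (forall f g h u,
    Psi (omV lambda kappa) x (Defs.dpair (Defs.dpair f g) h \ox u) =
    Psi (omV lambda kappa) y (Defs.dpair (Defs.dpair f g) h \ox u)) -> x = y.
Proof.
move=> lk xmu ymu xy; apply: (Psi_tens_inj lk xmu ymu) => f h u; move: f.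
apply: dual_tens_ext => [c f g|c f g|f g]; last exact: xy.
all: by rewrite (dpair_bilin _ _).1 linearPl linearP.
Qed.

Lemma Psi_tassoc lambda kappa mu X Y Z (z : tensmod X (tensmod Y Z)) f g h u :
  (lambda * mu)%g = kappa -> weight iota mu z ->
  Psi (omV lambda kappa) (tassoc X Y Z z : tensmod (tensmod X Y) Z)
    (Defs.dpair (Defs.dpair f g) h \ox u) =
  Psi (omV lambda kappa) z (Defs.dpair f (Defs.dpair g h) \ox u).
Proof.
move=> lk zmu; rewrite (PsiE _ _ lk zmu) (PsiE _ _ lk); last first.
  by move=> a; rewrite tassoc_hom zmu linearZ.
congr (omV _ _ _ _ _); apply/lfunP=> t; rewrite !ftildeE tassoc_hom.
by rewrite -dpair_tassoc [RHS]comp_lfunE.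
Qed.

Lemma omV_counit lambda : omV lambda lambda counit = stab_id (V lambda).
Proof.
by have [_ _ omK _] := om_iso lambda lambda; rewrite -(om_id lambda) omK //; apply: Stab_stab_id.
Qed.

Lemma weight_unitv : weight iota 1%g (unitv H).
Proof. by move=> a; rewrite mact_trivmod counit_iota // charT_oneE. Qed.

Lemma omVZ lambda kappa c f : Cmu iota (lambda * kappa^-1)%g f ->
  omV lambda kappa (c *: f) = c *: omV lambda kappa f.
Proof.
move=> fC; have [_ [_ omVl _] _ _] := om_iso lambda kappa.
have C0 : Cmu iota (lambda * kappa^-1)%g (0 : dual H).
  by move=> a h; rewrite !zero_lfunE mulr0.
have om0 : omV lambda kappa 0 = 0.
  by have := omVl 1 _ _ C0 C0; rewrite !scale1r addr0 => /esym/eqP;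
     rewrite -subr_eq0 addrK => /eqP.
by have := omVl c f 0 fC C0; rewrite om0 !addr0.
Qed.

(** The unit vector of the trivial module has weight 1 and f~^x = f(1) epsilon,
    which omega relates to the identity of V_lambda. *)
Lemma Psi_unitv lambda f u :
  Psi (omV lambda lambda) (unitv H) (f \ox u) = (f (unitv H) : k) *: u.
Proof.
rewrite (PsiE _ _ (mulg1 lambda) weight_unitv).
have -> : ftilde (unitv H) f = (f (unitv H) : k) *: counit.
  apply/lfunP=> h; rewrite ftildeE mact_trivmod counit_antipode linearZ.
  by rewrite scale_lfunE; apply: mulrC.
rewrite omVZ ?omV_counit; last first.
  by move=> a h; rewrite counitM (counit_iota iota_sub) mulgV charT_oneE.
by rewrite !scale_lfunE tens_funE counit1 scale1r id_lfunE.
Qed.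

Variables (I : charT k A -> tens H H) (I_fusion : is_fusion iota omV I).

Lemma fusion_weight lambda mu eta X Y (x : X) (y : Y) :
  weight iota mu x -> weight iota eta y ->
  weight iota (mu * eta)%g (tact X Y (I lambda) (x \ox y) : tensmod X Y).
Proof. by move=> xmu yeta; have [] := I_fusion lambda xmu yeta. Qed.

Lemma fusionE lambda kappa rho mu eta X Y (x : X) (y : Y) f g u :
  (lambda * mu)%g = kappa -> (kappa * eta)%g = rho ->
  weight iota mu x -> weight iota eta y ->
  Psi (omV lambda rho) (tact X Y (I lambda) (x \ox y) : tensmod X Y)
    (Defs.dpair f g \ox u) =
  Psi (omV kappa rho) y (g \ox Psi (omV lambda kappa) x (f \ox u)).
Proof.
move=> <- <- xmu yeta; have [_ /lfunP/(_ (g \ox (f \ox u)))] := I_fusion lambda xmu yeta.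
by rewrite !comp_lfunE dual_tens_canE tmapE id_lfunE.
Qed.

(** Applied to (f (x) g (x) h) (x) u, both sides become the same composite of
    Psi(lambda, x), Psi(lambda mu, y) and Psi(lambda mu eta, z). *)
Lemma fusion_cocycle lambda mu eta zeta X Y Z (x : X) (y : Y) (z : Z) :
    weight iota mu x -> weight iota eta y -> weight iota zeta z ->
  tact (tensmod X Y) Z (I lambda) (tact X Y (I lambda) (x \ox y) \ox z) =
  tassoc X Y Z (tact X (tensmod Y Z) (I lambda)
                  (x \ox tact Y Z (I (lambda * mu)%g) (y \ox z))).
Proof.
move=> xmu yeta zzeta.
have xyw := fusion_weight lambda xmu yeta.
have yzw := fusion_weight (lambda * mu)%g yeta zzeta.
have lw := fusion_weight lambda xyw zzeta.
have rw := fusion_weight lambda xmu yzw; rewrite mulgA in rw.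
have e1 : (lambda * (mu * eta * zeta) = lambda * mu * eta * zeta)%g by rewrite !mulgA.
apply: (Psi_tens3_inj e1) => //.
  by move=> a; rewrite tassoc_hom rw linearZ.
move=> f g h u; rewrite (Psi_tassoc _ _ _ _ e1 rw).
rewrite (fusionE _ _ _ (mulgA _ _ _) (erefl _)) //.
rewrite (fusionE _ _ _ (erefl _) (erefl _) xmu yeta).
by rewrite (fusionE _ _ _ (erefl _) _ xmu yzw) ?mulgA // (fusionE _ _ _ (erefl _) (erefl _) yeta zzeta).
Qed.

(** Psi of the unit vector only multiplies by a scalar, so the defining
    property of I reduces to Psi(lambda, x) up to that scalar. *)
Lemma fusion_unitr lambda mu X (x : X) : weight iota mu x ->
  tact X (trivmod H) (I lambda) (x \ox unitv H) = x \ox unitv H.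
Proof.
move=> xmu; have e := mulg1 (lambda * mu)%g.
have lw := fusion_weight lambda xmu weight_unitv; rewrite mulg1 in lw.
have rw : weight iota mu (x \ox unitv H : tensmod X (trivmod H)).
  by move=> a; rewrite mact_tens_trivr xmu linearZl_LR.
apply: (Psi_tens_inj (erefl _) lw rw) => f g u.
apply: etrans (fusionE _ _ _ (erefl _) e xmu weight_unitv) _; rewrite Psi_unitv.
rewrite (PsiE _ _ (erefl _) xmu) (PsiE _ _ (erefl _) rw).
have -> : ftilde (x \ox unitv H : tensmod X (trivmod H)) (Defs.dpair f g) =
    (g (unitv H) : k) *: ftilde x f.
  apply/lfunP=> h; rewrite ftildeE mact_tens_trivr dpairE scale_lfunE ftildeE.
  exact: mulrC.
by rewrite omVZ ?scale_lfunE //; apply: ftilde_Cmu xmu.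
Qed.

Lemma fusion_unitl lambda mu X (x : X) : weight iota mu x ->
  tact (trivmod H) X (I lambda) (unitv H \ox x) = unitv H \ox x.
Proof.
move=> xmu; have e := mulg1 lambda.
have lw := fusion_weight lambda weight_unitv xmu; rewrite mul1g in lw.
have rw : weight iota mu (unitv H \ox x : tensmod (trivmod H) X).
  by move=> a; rewrite mact_tens_trivl xmu linearZr_LR.
apply: (Psi_tens_inj (erefl _) lw rw) => f g u.
apply: etrans (fusionE _ _ _ e (erefl _) weight_unitv xmu) _; rewrite Psi_unitv.
rewrite linearZr_LR linearZ /=.
rewrite (PsiE _ _ (erefl _) xmu) (PsiE _ _ (erefl _) rw).
have -> : ftilde (unitv H \ox x : tensmod (trivmod H) X) (Defs.dpair f g) =
    (f (unitv H) : k) *: ftilde x g.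
  by apply/lfunP=> h; rewrite ftildeE mact_tens_trivl dpairE scale_lfunE ftildeE.
by rewrite omVZ ?scale_lfunE //; apply: ftilde_Cmu xmu.
Qed.

End Fusion.

(** * Multiplicative and antimultiplicative maps on tensor products *)

Section TensorAlgebraMaps.
Variable k : fieldType.
Implicit Types A B C D : falgType k.

Lemma tens_morphism_ext A B C (F : 'Hom(tens A B, C)) :
    (forall a b a' b',
       F ((a \ox b) * (a' \ox b')) = F (a \ox b) * F (a' \ox b')) ->
  forall s t, F (s * t) = F s * F t.
Proof.
move=> FM s t; move: s; apply: tens_ext => [c s u|c s u|a b].
- by rewrite mulrDl -scalerAl linearP.
- by rewrite linearP mulrDl -scalerAl.
move: t; apply: tens_ext => [c s u|c s u|a' b'] //.
- by rewrite mulrDr -scalerAr linearP.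
- by rewrite linearP mulrDr -scalerAr.
Qed.

Lemma tens_antimorphism_ext A B C (F : 'Hom(tens A B, C)) :
    (forall a b a' b',
       F ((a \ox b) * (a' \ox b')) = F (a' \ox b') * F (a \ox b)) ->
  forall s t, F (s * t) = F t * F s.
Proof.
move=> FM s t; move: s; apply: tens_ext => [c s u|c s u|a b].
- by rewrite mulrDl -scalerAl linearP.
- by rewrite linearP mulrDr -scalerAr.
move: t; apply: tens_ext => [c s u|c s u|a' b'] //.
- by rewrite mulrDr -scalerAr linearP.
- by rewrite linearP mulrDl -scalerAl.
Qed.

Lemma tmapM A B C D (f : 'Hom(A, C)) (g : 'Hom(B, D)) :
  (forall a b, f (a * b) = f a * f b) -> (forall a b, g (a * b) = g a * g b) ->
  forall s t : tens A B, tmap f g (s * t) = tmap f g s * tmap f g t.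
Proof.
move=> fM gM; apply: tens_morphism_ext => a b a' b'.
by rewrite tens_mulE !tmapE tens_mulE fM gM.
Qed.

Lemma tmap_antiM A B C D (f : 'Hom(A, C)) (g : 'Hom(B, D)) :
  (forall a b, f (a * b) = f b * f a) -> (forall a b, g (a * b) = g b * g a) ->
  forall s t : tens A B, tmap f g (s * t) = tmap f g t * tmap f g s.
Proof.
move=> fM gM; apply: tens_antimorphism_ext => a b a' b'.
by rewrite tens_mulE !tmapE tens_mulE fM gM.
Qed.

Lemma tflipM A B (s t : tens A B) :
  tflip A B (s * t) = tflip A B s * tflip A B t.
Proof.
move: s t; apply: tens_morphism_ext => a b a' b'.
by rewrite tens_mulE !tflipE tens_mulE.
Qed.

Lemma tassocM A B C (s t : tens A (tens B C)) :
  tassoc A B C (s * t) = tassoc A B C s * tassoc A B C t.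
Proof.
move: s t; apply: tens_morphism_ext => a s a' t; rewrite tens_mulE.
move: s; apply: tens_ext => [c s u|c s u|b c].
- by rewrite mulrDl -scalerAl linearPr linearP.
- by rewrite linearPr linearP mulrDl -scalerAl.
move: t; apply: tens_ext => [d s u|d s u|b' c'].
- by rewrite mulrDr -scalerAr linearPr linearP.
- by rewrite linearPr linearP mulrDr -scalerAr.
by rewrite tens_mulE !tassocE !tens_mulE.
Qed.

Lemma tassoc1 A B C : tassoc A B C 1 = 1.
Proof. by rewrite !tens_oneE tassocE. Qed.

Lemma mact_regmod (H : hopfType k) (a b : H) :
  Defs.mact (regmod H) a b = a * b.
Proof. by rewrite /= (lfunE (@amull k H : {linear H -> 'End(H)})) lfunE. Qed.

Lemma tact_regmod (H : hopfType k) (s t : tens H H) :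
  tact (regmod H) (regmod H) s t = s * t.
Proof.
move: s; apply: tens_ext => [c s u|c s u|a b].
- by rewrite linearP add_lfunE scale_lfunE.
- by rewrite mulrDl -scalerAl.
move: t; apply: tens_ext => [c s u|c s u|a' b'].
- by rewrite linearP.
- by rewrite mulrDr -scalerAr.
by rewrite tens_mulE tactE tmapE !mact_regmod.
Qed.

Lemma tact_regmodl (H : hopfType k) (s : tens H H) (t : tens (tens H H) H) :
  tact (tensmod (regmod H) (regmod H)) (regmod H) s t = tmap comul \1 s * t.
Proof.
move: s; apply: tens_ext => [c s u|c s u|a b].
- by rewrite linearP add_lfunE scale_lfunE.
- by rewrite linearP mulrDl -scalerAl.
move: t; apply: tens_ext => [c s u|c s u|s c].
- by rewrite linearP.
- by rewrite mulrDr -scalerAr.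
rewrite tactE [LHS]tmapE mact_tensmod tact_regmod mact_regmod.
by rewrite tmapE id_lfunE tens_mulE.
Qed.

Lemma tact_regmodr (H : hopfType k) (s : tens H H) (t : tens H (tens H H)) :
  tact (regmod H) (tensmod (regmod H) (regmod H)) s t = tmap \1 comul s * t.
Proof.
move: s; apply: tens_ext => [c s u|c s u|a b].
- by rewrite linearP add_lfunE scale_lfunE.
- by rewrite linearP mulrDl -scalerAl.
move: t; apply: tens_ext => [c s u|c s u|c s].
- by rewrite linearP.
- by rewrite mulrDr -scalerAr.
rewrite tactE [LHS]tmapE mact_tensmod tact_regmod mact_regmod.
by rewrite tmapE id_lfunE tens_mulE.
Qed.

End TensorAlgebraMaps.

Lemma lrinv_eq (R : nzRingType) (u v w : R) : u * v = 1 -> v * w = 1 -> u = w.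
Proof. by move=> uv vw; rewrite -[u]mulr1 -vw mulrA uv mul1r. Qed.

(** * From the relations for I to the twist equations for J *)

Section Twist.
Variables (k : closedFieldType) (char0 : [pchar k] =i pred0).
Variables (H : hopfType k) (A : finGroupType) (abelianA : abelian [set: A]).
Variables (iota : A -> H) (iota_sub : grouplike_subgroup iota).
Local Notation Ahat := (charT k A).
Local Notation Pc := (Pchar iota).
Local Notation SV := (antipodeV H).
Variable I : Ahat -> tens H H.
Hypothesis I_unit : forall lambda : Ahat, I lambda \is a GRing.unit.

Lemma weight_Pchar (mu : Ahat) : weight iota mu (Pc mu : regmod H).
Proof. by move=> a; rewrite mact_regmod iota_Pchar. Qed.

Lemma Pchar_ext2 (s t : tens H H) :
  (forall mu nu, s * (Pc mu \ox Pc nu) = t * (Pc mu \ox Pc nu)) -> s = t.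
Proof.
move=> st; have one2 : (1 : tens H H) = \sum_mu \sum_nu Pc mu \ox Pc nu.
  rewrite tens_oneE -{1}(sum_Pchar char0 abelianA iota_sub) linear_sumlz.
  apply: eq_bigr => mu _.
  by rewrite -(sum_Pchar char0 abelianA iota_sub) linear_sumr.
rewrite -[s]mulr1 -[t]mulr1 one2 !mulr_sumr; apply: eq_bigr => mu _.
by rewrite !mulr_sumr; apply: eq_bigr => nu _.
Qed.

Lemma Pchar_ext3 (s t : tens (tens H H) H) :
  (forall mu nu rho, s * (Pc mu \ox Pc nu \ox Pc rho) =
                     t * (Pc mu \ox Pc nu \ox Pc rho)) -> s = t.
Proof.
move=> st; have sP := sum_Pchar char0 abelianA iota_sub.
have one3 : (1 : tens (tens H H) H) =
    \sum_mu \sum_nu \sum_rho Pc mu \ox Pc nu \ox Pc rho.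
  rewrite !tens_oneE -{1}sP !linear_sumlz; apply: eq_bigr => mu _.
  rewrite -{1}sP linear_sumr linear_sumlz; apply: eq_bigr => nu _.
  by rewrite -sP linear_sumr.
rewrite -[s]mulr1 -[t]mulr1 one3 !mulr_sumr; apply: eq_bigr => mu _.
rewrite !mulr_sumr; apply: eq_bigr => nu _.
by rewrite !mulr_sumr; apply: eq_bigr => rho _.
Qed.

(** The antiautomorphism a (x) b |-> S^-1(b) (x) S^-1(a) of H (x) H, which maps
    I(lambda)^-1 to J(lambda). *)
Definition flip_antipodeV : 'End(tens H H) := (tmap SV SV \o tflip H H)%VF.

Lemma flip_antipodeVE a b : flip_antipodeV (a \ox b) = SV b \ox SV a.
Proof. by rewrite comp_lfunE tflipE tmapE. Qed.

Lemma flip_antipodeVM s t :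
  flip_antipodeV (s * t) = flip_antipodeV t * flip_antipodeV s.
Proof.
by rewrite !comp_lfunE tflipM tmap_antiM //; apply: antipodeVM.
Qed.

Lemma flip_antipodeV1 : flip_antipodeV 1 = 1.
Proof. by rewrite tens_oneE flip_antipodeVE antipodeV1. Qed.

Lemma fusion_twistE lambda : fusion_twist I lambda = flip_antipodeV (I lambda)^-1.
Proof. by rewrite /fusion_twist comp_lfunE. Qed.

Lemma flip_antipodeV_unit s : s \is a GRing.unit ->
  flip_antipodeV s^-1 \is a GRing.unit.
Proof.
move=> su; apply/unitrP; exists (flip_antipodeV s).
by rewrite -!flip_antipodeVM mulrV ?mulVr // flip_antipodeV1.
Qed.

(** Both a (x) a and I(lambda) can be tested on the vectors P_mu (x) P_eta: there
    a (x) a acts by (mu eta)(a), and it acts by the same scalar on their images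
    under I(lambda). *)
Lemma fusion_commute :
    (forall lambda mu eta, weight iota (mu * eta)%g
       (I lambda * (Pc mu \ox Pc eta) : tensmod (regmod H) (regmod H))) ->
  forall lambda a, I lambda * (iota a \ox iota a) = (iota a \ox iota a) * I lambda.
Proof.
move=> Iw lambda a; apply: Pchar_ext2 => mu nu.
have := Iw lambda mu nu a.
rewrite mact_tensmod tact_regmod (comul_iota iota_sub) mulrA => ->.
rewrite -mulrA tens_mulE !(iota_Pchar iota_sub) linearZl_LR linearZr_LR /=.
by rewrite charT_mulE -!scalerAr scalerA.
Qed.

Lemma twist_commute lambda a :
    (forall b, I lambda * (iota b \ox iota b) = (iota b \ox iota b) * I lambda) ->
  fusion_twist I lambda * (iota a \ox iota a) =
  (iota a \ox iota a) * fusion_twist I lambda.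
Proof.
move=> Ic; rewrite fusion_twistE.
have -> : iota a \ox iota a = flip_antipodeV (iota a^-1%g \ox iota a^-1%g).
  by rewrite flip_antipodeVE (antipodeV_iota iota_sub) invgK.
rewrite -!flip_antipodeVM; congr (flip_antipodeV _).
by apply: commrV; apply: esym (Ic _).
Qed.

Local Notation counit_l := (contractl H (@counit k H)).
Local Notation counit_r := (contractr H (@counit k H)).

Lemma counit_lM s t : counit_l (s * t) = counit_l s * counit_l t.
Proof.
move: s t; apply: tens_morphism_ext => a b a' b'.
by rewrite tens_mulE !contractlE counitM -scalerAl -scalerAr scalerA.
Qed.

Lemma counit_rM s t : counit_r (s * t) = counit_r s * counit_r t.
Proof.
move: s t; apply: tens_morphism_ext => a b a' b'.
by rewrite tens_mulE !contractrE counitM -scalerAl -scalerAr scalerA.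
Qed.

Lemma counit_lV s : s \is a GRing.unit -> counit_l s = 1 -> counit_l s^-1 = 1.
Proof.
move=> su s1; rewrite -[LHS]mulr1 -[X in _ * X]s1 -counit_lM mulVr //.
by rewrite tens_oneE contractlE counit1 scale1r.
Qed.

Lemma counit_rV s : s \is a GRing.unit -> counit_r s = 1 -> counit_r s^-1 = 1.
Proof.
move=> su s1; rewrite -[LHS]mulr1 -[X in _ * X]s1 -counit_rM mulVr //.
by rewrite tens_oneE contractrE counit1 scale1r.
Qed.

Lemma counit_l_flip s : counit_l (flip_antipodeV s) = SV (counit_r s).
Proof.
move: s; apply: tens_ext => [c s t|c s t|a b]; try by rewrite !linearP.
by rewrite flip_antipodeVE contractlE contractrE linearZ /= counit_antipodeV.
Qed.

Lemma counit_r_flip s : counit_r (flip_antipodeV s) = SV (counit_l s).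
Proof.
move: s; apply: tens_ext => [c s t|c s t|a b]; try by rewrite !linearP.
by rewrite flip_antipodeVE contractlE contractrE linearZ /= counit_antipodeV.
Qed.

Lemma tact_trivr (X : fdmod H) s (x : X) :
  tact X (trivmod H) s (x \ox unitv H) = Defs.mact X (counit_r s) x \ox unitv H.
Proof.
move: s; apply: tens_ext => [c s t|c s t|a b].
- by rewrite linearP add_lfunE scale_lfunE.
- by rewrite !linearP add_lfunE scale_lfunE linearPl.
rewrite tactE tmapE mact_trivmod contractrE linearZ scale_lfunE.
by rewrite linearZl_LR linearZr_LR.
Qed.

Lemma tact_trivl (X : fdmod H) s (x : X) :
  tact (trivmod H) X s (unitv H \ox x) = unitv H \ox Defs.mact X (counit_l s) x.
Proof.
move: s; apply: tens_ext => [c s t|c s t|a b].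
- by rewrite linearP add_lfunE scale_lfunE.
- by rewrite !linearP add_lfunE scale_lfunE linearPr.
rewrite tactE tmapE mact_trivmod contractlE linearZ scale_lfunE.
by rewrite linearZl_LR linearZr_LR.
Qed.

Lemma unitv_ox_inj (U : vectType k) (u v : U) : unitv H \ox u = unitv H \ox v -> u = v.
Proof.
pose f : 'Hom(tens k^o U, U) := linfun (tlift (fun (c : k^o) (w : U) => (c : k) *: w)).
have fE w : f (unitv H \ox w) = w.
  rewrite lfunE /= tliftE ?scale1r //; split=> [b|b] c s t /=.
    by rewrite scalerDl scalerA.
  by rewrite scalerDr !scalerA mulrC.
by move/(congr1 f); rewrite !fE.
Qed.

Lemma ox_unitv_inj (U : vectType k) (u v : U) : u \ox unitv H = v \ox unitv H -> u = v.
Proof. by move/(congr1 (tflip _ _)); rewrite !tflipE => /unitv_ox_inj. Qed.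

Lemma Pchar_ext1 (s t : H) : (forall mu, s * Pc mu = t * Pc mu) -> s = t.
Proof.
move=> st; rewrite -[s]mulr1 -[t]mulr1 -(sum_Pchar char0 abelianA iota_sub).
by rewrite !mulr_sumr; apply: eq_bigr => mu _.
Qed.

(** The operator that applies F(lambda mu) to the last two factors of a tensor
    whose first factor has weight mu. *)
Definition weight_shift (F : Ahat -> tens H H) lambda : tens H (tens H H) :=
  \sum_mu Pc mu \ox F (lambda * mu)%g.

Lemma weight_shiftM (F G : Ahat -> tens H H) lambda :
  weight_shift F lambda * weight_shift G lambda =
  weight_shift (fun mu => F mu * G mu) lambda.
Proof.
rewrite mulr_suml; apply: eq_bigr => mu _; rewrite mulr_sumr (bigD1 mu) //=.
rewrite tens_mulE (PcharM char0 iota_sub) eqxx scale1r big1 ?addr0 // => nu /negPf nm.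
by rewrite tens_mulE (PcharM char0 iota_sub) eq_sym nm scale0r linear0l.
Qed.

Lemma weight_shift1 lambda : weight_shift (fun=> 1) lambda = 1.
Proof.
by rewrite /weight_shift -linear_sumlz (sum_Pchar char0 abelianA iota_sub).
Qed.

Lemma fusion_pentagon :
  (forall lambda mu nu rho,
     tmap comul \1 (I lambda) * ((I lambda * (Pc mu \ox Pc nu)) \ox Pc rho) =
     tassoc H H H (tmap \1 comul (I lambda) *
       (Pc mu \ox (I (lambda * mu)%g * (Pc nu \ox Pc rho))))) ->
  forall lambda, tmap comul \1 (I lambda) * (I lambda \ox 1) =
    tassoc H H H (tmap \1 comul (I lambda) * weight_shift I lambda).
Proof.
move=> Ic lambda; apply: Pchar_ext3 => mu nu rho.
rewrite -mulrA tens_mulE mul1r Ic -tassocE -tassocM -mulrA.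
congr (tassoc _ _ _ (_ * _)).
rewrite mulr_suml (bigD1 mu) //= tens_mulE (PcharM char0 iota_sub) eqxx scale1r.
rewrite big1 ?addr0 // => eta /negPf em.
by rewrite tens_mulE (PcharM char0 iota_sub) em scale0r linear0l.
Qed.

(** Both sides are inverses of the two sides of the hypothesis, as
    F |-> weight_shift F is multiplicative. *)
Lemma fusion_pentagonV lambda :
    tmap comul \1 (I lambda) * (I lambda \ox 1) =
      tassoc H H H (tmap \1 comul (I lambda) * weight_shift I lambda) ->
  ((I lambda)^-1 \ox 1) * tmap comul \1 (I lambda)^-1 =
  tassoc H H H (weight_shift (fun mu => (I mu)^-1) lambda *
                tmap \1 comul (I lambda)^-1).
Proof.
move=> E; have idM (a b : H) : (\1%VF : 'End(H)) (a * b) = (\1%VF : 'End(H)) a * (\1%VF : 'End(H)) b.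
  by rewrite !id_lfunE.
have cM := @comulM k H.
apply: (@lrinv_eq _ _ (tmap comul \1 (I lambda) * (I lambda \ox 1))).
  rewrite mulrA -[X in X * _]mulrA -tmapM // mulVr //.
  by rewrite tens_oneE tmapE id_lfunE comul1 mulr1 tens_mulE mulVr // mulr1.
rewrite E -tassocM mulrA -[X in X * _]mulrA weight_shiftM.
have -> : weight_shift (fun mu => I mu * (I mu)^-1) lambda = 1.
  by rewrite -(weight_shift1 lambda); apply: eq_bigr => mu _; rewrite mulrV.
rewrite mulr1 -tmapM // mulrV //.
by rewrite tens_oneE tmapE id_lfunE comul1 tassoc1.
Qed.

(** The antiautomorphism a (x) b (x) c |-> S^-1(c) (x) S^-1(b) (x) S^-1(a), once
    for each bracketing of the source; the target has the other bracketing. *)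
Definition flip3_left : 'Hom(tens (tens H H) H, tens H (tens H H)) :=
  (tflip _ _ \o tmap flip_antipodeV SV)%VF.
Definition flip3_right : 'Hom(tens H (tens H H), tens (tens H H) H) :=
  (tflip _ _ \o tmap SV flip_antipodeV)%VF.

Lemma flip3_leftE s a : flip3_left (s \ox a) = SV a \ox flip_antipodeV s.
Proof. by rewrite comp_lfunE tmapE tflipE. Qed.
Lemma flip3_rightE s a : flip3_right (a \ox s) = flip_antipodeV s \ox SV a.
Proof. by rewrite comp_lfunE tmapE tflipE. Qed.

Lemma flip3_leftM s t : flip3_left (s * t) = flip3_left t * flip3_left s.
Proof.
rewrite !comp_lfunE tmap_antiM ?tflipM //; [exact: flip_antipodeVM | exact: antipodeVM].
Qed.
Lemma flip3_rightM s t : flip3_right (s * t) = flip3_right t * flip3_right s.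
Proof.
rewrite !comp_lfunE tmap_antiM ?tflipM //; [exact: antipodeVM | exact: flip_antipodeVM].
Qed.

Lemma tassoc_flip3 z :
  tassoc H H H (flip3_left (tassoc H H H z)) = flip3_right z.
Proof.
move: z; apply: tens_ext => [c s t|c s t|a s]; try by rewrite !linearP.
move: s; apply: tens_ext => [c s t|c s t|b c]; try by rewrite linearPr !linearP.
by rewrite tassocE flip3_leftE flip3_rightE !flip_antipodeVE tassocE.
Qed.

Lemma flip_antipodeV_comul h : flip_antipodeV (comul h) = comul (SV h).
Proof. by rewrite comul_antipodeV comp_lfunE. Qed.

Lemma flip3_left_comul s :
  flip3_left (tmap comul \1 s) = tmap \1 comul (flip_antipodeV s).
Proof.
move: s; apply: tens_ext => [c s t|c s t|a b]; try by rewrite !linearP.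
rewrite tmapE id_lfunE flip3_leftE flip_antipodeV_comul.
by rewrite flip_antipodeVE tmapE id_lfunE.
Qed.

Lemma flip3_right_comul s :
  flip3_right (tmap \1 comul s) = tmap comul \1 (flip_antipodeV s).
Proof.
move: s; apply: tens_ext => [c s t|c s t|a b]; try by rewrite !linearP.
rewrite tmapE id_lfunE flip3_rightE flip_antipodeV_comul.
by rewrite flip_antipodeVE tmapE id_lfunE.
Qed.

(** The image of the inverted relation under the threefold flip. It turns
    P_mu into P_{mu^-1}, which accounts for lambda mu^-1 in the twist equation. *)
Lemma twist_of_fusion_cocycle lambda :
    tmap comul \1 (I lambda) * (I lambda \ox 1) =
      tassoc H H H (tmap \1 comul (I lambda) * weight_shift I lambda) ->
  \sum_(mu : Ahat) tmap comul \1 (fusion_twist I lambda) *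
        (fusion_twist I (lambda * mu^-1)%g \ox Pc mu) =
  tassoc H H H (tmap \1 comul (fusion_twist I lambda) *
                (1 \ox fusion_twist I lambda)).
Proof.
move=> /fusion_pentagonV/(congr1 (fun z => tassoc H H H (flip3_left z))).
rewrite tassoc_flip3 flip3_leftM flip3_rightM flip3_left_comul flip3_right_comul.
rewrite flip3_leftE antipodeV1 -!fusion_twistE => ->.
rewrite -mulr_sumr linear_sum; congr (_ * _).
rewrite [RHS](reindex invg) /=; last by exists invg => a _; rewrite invgK.
apply: eq_bigr => mu _; rewrite flip3_rightE -fusion_twistE.
by rewrite (antipodeV_Pchar iota_sub) invgK.
Qed.

End Twist.

Theorem proposition3p14
  (k : closedFieldType) (char0 : [pchar k] =i pred0)
  (H : hopfType k)
  (A : finGroupType) (abelianA : abelian [set: A])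
  (iota : A -> H) (iota_sub : grouplike_subgroup iota)
  (K : comodAlg H) (V : charT k A -> fdmod K)
  (datum : dynamical_datum iota V)
  (om : forall lambda mu : charT k A,
     'Hom(H, 'Hom(V lambda, V mu)) -> dual H)
  (omV : forall lambda mu : charT k A,
     dual H -> 'Hom(H, 'Hom(V lambda, V mu)))
  (om_iso : forall lambda mu : charT k A,
     Hiso (@Stab k H K (V lambda) (V mu)) (Cmu iota (lambda * mu^-1)%g)
          (om lambda mu) (omV lambda mu))
  (om_id : forall lambda : charT k A,
     om lambda lambda (stab_id (V lambda)) = counit)
  (I : charT k A -> tens H H)
  (I_fusion : is_fusion iota omV I)
  (I_unit : forall lambda : charT k A, I lambda \is a GRing.unit) :
  dynamical_twist iota (fusion_twist I).
Proof.
have wP := weight_Pchar iota_sub.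
split=> lambda.
- by rewrite fusion_twistE flip_antipodeV_unit.
- move=> a; apply: twist_commute => // b.
  apply: fusion_commute => // nu mu eta.
  have := fusion_weight I_fusion nu (wP mu) (wP eta).
  by rewrite tact_regmod.
- apply: twist_of_fusion_cocycle => //; apply: fusion_pentagon => // {}lambda mu nu rho.
  have := fusion_cocycle iota_sub om_iso I_fusion lambda (wP mu) (wP nu) (wP rho).
  by rewrite tact_regmodl tact_regmodr !tact_regmod.
- rewrite -[LHS]lfunE -/(contractl H counit) fusion_twistE counit_l_flip counit_rV ?antipodeV1 //.
  apply: (Pchar_ext1 char0 abelianA iota_sub) => mu; apply/(@ox_unitv_inj _ H).
  have := fusion_unitr iota_sub om_iso om_id I_fusion lambda (wP mu).
  by rewrite tact_trivr mact_regmod mul1r.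
rewrite -[LHS]lfunE -/(contractr H counit) fusion_twistE counit_r_flip counit_lV ?antipodeV1 //.
apply: (Pchar_ext1 char0 abelianA iota_sub) => mu; apply/(@unitv_ox_inj _ H).
have := fusion_unitl iota_sub om_iso om_id I_fusion lambda (wP mu).
by rewrite tact_trivl mact_regmod mul1r.
Qed.
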